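(* Let $k \ge 4$ be a fixed integer. The $k$-colour bipartite Ramsey number of the cycle $C_{2n}$ of order $2n$ is at most $(2k-3+o(1))n$, and likewise the $k$-colour bipartite Ramsey number of the path $P_{2n}$ of order $2n$ is at most $(2k-3+o(1))n$, where $o(1)$ denotes a quantity tending to $0$ as $n \to \infty$ (with $k$ fixed).
   Context: The $k$-colour bipartite Ramsey number of a bipartite graph $H$ is the least integer $N$ such that every $k$-edge-colouring of the complete bipartite graph $K_{N,N}$ contains a monochromatic copy of $H$. The order of a path or cycle is its number of vertices. *)

(* Defs.v *)
From mathcomp Require Import all_boot all_order all_algebra.
From mathcomp Require Import all_classical all_reals all_analysis.
Set Implicit Arguments.
Unset Strict Implicit.
Unset Printing Implicit Defensive.

(* A finite graph is given by its adjacency relation on a finite type.        *)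

(* This is a simple graph only for m >= 3: 'I_1 gets a loop, 'I_2 one edge.   *)
Definition cycle_graph (m : nat) : rel 'I_m :=
  fun i j => (j == ordS i) || (i == ordS j).
Arguments cycle_graph m : clear implicits.

Definition path_graph (m : nat) : rel 'I_m :=
  fun i j => (j == i.+1 :> nat) || (i == j.+1 :> nat).
Arguments path_graph m : clear implicits.

(* The vertices of K_{N,N} are 'I_N + 'I_N.  Its edges are the pairs          *)
(* {inl i, inr j}, so a k-edge-colouring is a map col : 'I_N -> 'I_N -> 'I_k. *)
Definition colour_class (k N : nat) (col : 'I_N -> 'I_N -> 'I_k) (c : 'I_k) :
    rel ('I_N + 'I_N) :=
  fun u v => match u, v with
    | inl i, inr j | inr j, inl i => col i j == c
    | _, _ => false
    end.

(* Copies are subgraphs, not necessarily induced. *)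
Definition contains_copy (V W : finType) (G : rel W) (H : rel V) : Prop :=
  exists2 f : V -> W, injective f & forall x y, H x y -> G (f x) (f y).

Definition bipartite_arrows (k : nat) (V : finType) (H : rel V) (N : nat) :
    Prop :=
  forall col : 'I_N -> 'I_N -> 'I_k,
    exists c : 'I_k, contains_copy (colour_class col c) H.

Definition is_bipartite_ramsey_number (k : nat) (V : finType) (H : rel V)
    (N : nat) : Prop :=
  bipartite_arrows k H N /\ forall M : nat, bipartite_arrows k H M -> N <= M.

(* Main.v *)
(* Bad pairs of a vertex partition are removed by a linear energy argument: a   *)
(* pair of classes is good when each colour occurring in it meets every pair    *)
(* of large subsets, and refining along a violation makes a colour disappear    *)
(* from a positive proportion of the pair.  A good pair therefore has a popular *)
(* colour in which long paths of prescribed length exist, and a large matching  *)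
(* in a monochromatic component of the reduced graph yields a C_{2n}.  If no    *)
(* component has a matching of size s, Koenig's theorem gives covers of size    *)
(* at most s of all components.  Let T_u be the set of colours in whose cover   *)
(* the vertex u lies.  Counting edges component by component, and using that    *)
(* T_u is never empty, many vertices have |T_u| = 1.  If A1_c and B1_c are the  *)
(* vertices of either side with T_u = {c}, all edges between A1_c and B1_c have *)
(* colour c, so they share a component.  Hence for some c one of these sets, say *)
(* A1_c, has more than s vertices; it meets exactly two components of colour c, *)
(* which contain almost all the other side.  Removing their covers from the     *)
(* left and restricting the right to them deletes the colour c at a cost of     *)
(* about 2s on each side, so induction on k reduces to three colours with sides *)
(* of total size 7s, where all three colours behave in this way and a counting  *)
(* of blocks gives a contradiction.                                             *)
Require Import Defs.
From mathcomp Require Import all_boot zify.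
Set Implicit Arguments.
Unset Strict Implicit.
Unset Printing Implicit Defensive.

(** A regularity partition cuts both sides of the host graph into clusters of [m] vertices. In the
    reduced graph a bad pair becomes a non-edge ([None]) and a good pair carries one popular colour.
    If a component of some colour contains a matching of [s] reduced edges, [long_cycle] runs once
    round it and inserts paths of prescribed even order into the matched pairs, so every suitable
    even order up to nearly [2 * s * m] is attained. Otherwise [koenig] covers every monochromatic
    component by at most [s] clusters, which [cfg_false] refutes as soon as each side has slightly
    more than [(2k - 3)s] clusters. With [s] about [n / m] this happens for [N] slightly above
    [(2k - 3)n]; [cycle_arrows] fixes the parameters and [ramsey_asymptotics] passes to the limit.

    The heart is [cfg_false]. By [count_once] some colour is the only covering colour of more than
    [s] vertices, and these lie on one side up to few exceptions; [delete_colour] then removes this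
    colour. The induction ends at three colours in [cfg_three_false]: there each colour is of this
    kind, two of them on the same side, and [richAAA] and [richAAB] compare block sizes. The number
    [h] of missing edges at a cluster is absorbed by a slack [d > 100 * h] throughout. *)

Ltac card_lia := repeat (match goal with |- context [#|?S|] => move: #|S| end);
  clear; intros; lia.

(** * Koenig's theorem *)

Definition nbhd (I J : finType) (R : I -> J -> bool) (Z : {set J}) (S : {set I}) :=
  [set j in Z | [exists i in S, R i j]].

Lemma nbhdP (I J : finType) (R : I -> J -> bool) (Z : {set J}) (S : {set I}) j :
  reflect (j \in Z /\ exists2 i, i \in S & R i j) (j \in nbhd R Z S).
Proof.
rewrite inE; apply: (iffP andP) => -[jZ].
  by move/exists_inP.
by move=> ?; split=> //; apply/exists_inP.
Qed.

(** Induction on [#|X|]. If every non-empty proper subset has a spare neighbour, any edge at [i0]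
    can be fixed and its ends removed. Otherwise a tight subset [S0] is matched into its
    neighbourhood and the rest of [X] outside that neighbourhood. The option type spares a default
    element of [J], which may be empty. *)
Lemma hall (I J : finType) (R : I -> J -> bool) (X : {set I}) (Z : {set J}) :
  (forall S : {set I}, S \subset X -> #|S| <= #|nbhd R Z S|) ->
  exists2 f : I -> option J, {in X &, injective f} &
    forall i, i \in X -> exists2 j, f i = Some j & (j \in Z) && R i j.
Proof.
have [n] := ubnP #|X|; elim: n X Z => // n IHn X Z; rewrite ltnS => leXn hallX.
have [->|[i0 i0X]] := set_0Vmem X.
  by exists (fun=> None) => [i|i]; rewrite inE.
case: (boolP [forall S : {set I},
   [&& S \proper X & S != set0] ==> (#|S| < #|nbhd R Z S|)]) => [/forallP slack|].
  have : 0 < #|nbhd R Z [set i0]|.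
    apply: leq_trans (hallX _ _); last by rewrite sub1set.
    by rewrite cards1.
  case/card_gt0P=> j0 /nbhdP[j0Z [_ /set1P -> Rij0]].
  have [||f finj fP] := IHn (X :\ i0) (Z :\ j0).
  - by rewrite (leq_trans _ leXn)// [in X in _ < X](cardsD1 i0) i0X.
  - move=> S SX; have [->|Sn0] := eqVneq S set0; first by rewrite cards0.
    have ltS : #|S| < #|nbhd R Z S|.
      have /implyP := slack S; apply; rewrite Sn0 andbT.
      by apply: (sub_proper_trans SX); apply: properD1.
    have : nbhd R Z S \subset j0 |: nbhd R (Z :\ j0) S.
      apply/subsetP => j /nbhdP[jZ jS]; rewrite in_setU1.
      case: eqVneq => //= jj0; apply/nbhdP; split=> //.
      by rewrite !inE jj0.
    move/subset_leq_card; rewrite cardsU1; case: (_ \notin _) => /=; lia.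
  exists (fun i => if i == i0 then Some j0 else f i).
    move=> i i' iX i'X; case: (eqVneq i i0) => [->|ii0]; case: (eqVneq i' i0) => [->|i'i0] //.
    - have [|j -> ] := fP i'; first by rewrite !inE i'i0.
      by rewrite !inE => /andP[/andP[/eqP jj0 _] _] [e]; case: jj0.
    - have [|j -> ] := fP i; first by rewrite !inE ii0.
      by rewrite !inE => /andP[/andP[/eqP jj0 _] _] [e]; case: jj0.
    - by apply: finj; rewrite !inE ?ii0 ?i'i0.
  move=> i iX; case: (eqVneq i i0) => [->|ii0]; first by exists j0; rewrite ?j0Z.
  have [|j -> /andP[]] := fP i; first by rewrite !inE ii0.
  by rewrite !inE => /andP[_ jZ] Rij; exists j; rewrite ?jZ.
rewrite negb_forall => /existsP[S0]; rewrite negb_imply -leqNgt => /andP[/andP[S0X S0n] tight].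
have tight' : #|nbhd R Z S0| = #|S0|.
  by apply/eqP; rewrite eqn_leq tight hallX// proper_sub.
have S0sub := proper_sub S0X.
have ltS0 := proper_card S0X.
have [||f finj fP] := IHn S0 Z.
- by rewrite (leq_trans ltS0).
- by move=> S SS0; apply: hallX; apply: subset_trans S0sub.
have [||g ginj gP] := IHn (X :\: S0) (Z :\: nbhd R Z S0).
- rewrite cardsD (setIidPr S0sub); have : 0 < #|S0| by rewrite card_gt0.
  lia.
- move=> S SX.
  have dis : S :&: S0 = set0.
    apply/setP=> i; rewrite !inE; apply/negbTE; apply/andP => -[iS].
    by move/subsetP: SX => /(_ _ iS); rewrite inE => /andP[/negP].
  have /hallX : S :|: S0 \subset X.
    by rewrite subUset S0sub andbT (subset_trans SX)// subsetDl.
  rewrite cardsU dis cards0 subn0.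
  have : nbhd R Z (S :|: S0) \subset nbhd R (Z :\: nbhd R Z S0) S :|: nbhd R Z S0.
    apply/subsetP => j /nbhdP[jZ [i]]; rewrite inE => iSS0 Rij.
    rewrite inE orbC; case: (boolP (j \in nbhd R Z S0)) => //= jn.
    apply/nbhdP; split; first by rewrite inE jn.
    case/orP: iSS0 => [iS|iS0]; first by exists i.
    by case/negP: jn; apply/nbhdP; split=> //; exists i.
  move/subset_leq_card => h1 h2; have := leq_trans h2 h1.
  rewrite cardsU tight'; lia.
exists (fun i => if i \in S0 then f i else g i).
  have cross i i' : i \in S0 -> i' \in X -> i' \notin S0 -> f i <> g i'.
    move=> iS i'X i'S; have [j -> /andP[jZ Rij]] := fP i iS.
    have [|j' -> /andP[]] := gP i'; first by rewrite inE i'S.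
    rewrite inE => /andP[/negP jn _] _ [e]; apply: jn; rewrite -e.
    by apply/nbhdP; split=> //; exists i.
  move=> i i' iX i'X; case: ifPn => iS; case: ifPn => i'S.
  - exact: finj.
  - by move/cross => /(_ iS i'X i'S).
  - by move/esym/cross => /(_ i'S iX iS).
  - by apply: ginj; rewrite inE ?iS ?i'S.
move=> i iX; case: ifPn => iS; first exact: fP.
have [|j -> ] := gP i; first by rewrite inE iS.
by rewrite inE => /andP[/andP[_ jZ] Rij]; exists j; rewrite ?jZ.
Qed.

Definition is_matching (I J : eqType) (R : I -> J -> bool) (s : seq (I * J)) :=
  [&& uniq (map fst s), uniq (map snd s) & all (fun p => R p.1 p.2) s].

Lemma hall_seq (I J : finType) (R : I -> J -> bool) (X : {set I}) (Z : {set J}) :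
  (forall S : {set I}, S \subset X -> #|S| <= #|nbhd R Z S|) ->
  exists s : seq (I * J), [/\ is_matching R s, map fst s = enum X & {subset map snd s <= Z}].
Proof.
move=> /hall[f finj fP].
exists (pmap (fun i => omap (pair i) (f i)) (enum X)).
set s := pmap _ _.
have sP i j : (i, j) \in s -> i \in X /\ f i = Some j.
  rewrite mem_pmap => /mapP[i']; rewrite mem_enum => i'X.
  by case E : (f i') => [j'|] //= -[-> ->].
have m1 : map fst s = enum X.
  rewrite /s; have : {in enum X, forall i, f i <> None}.
    by move=> i; rewrite mem_enum => /fP[j ->].
  elim: (enum X) => //= i t IH fn.
  case E : (f i) => [j|] /=; last by case: (fn i); rewrite ?inE ?eqxx.
  by rewrite IH// => i' it; apply: fn; rewrite inE it orbT.
have us : uniq s by apply: (@map_uniq _ _ fst); rewrite m1 enum_uniq.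
split=> //; first apply/and3P; first split.
- by rewrite m1 enum_uniq.
- rewrite map_inj_in_uniq// => -[i j] [i' j'] /sP[iX fi] /sP[i'X fi'] /= e.
  by rewrite e in fi *; rewrite (finj i i')// fi fi'.
- apply/allP => -[i j] /sP[iX fi] /=; have [j' + /andP[_]] := fP i iX.
  by rewrite fi => -[->].
- move=> j /mapP[[i j'] /sP[iX fi] /= ->]; have [j'' + /andP[+ _]] := fP i iX.
  by rewrite fi => -[->].
Qed.

Definition is_cover (I J : finType) (R : I -> J -> bool) (P : {set I} * {set J}) :=
  [forall i, forall j, R i j ==> (i \in P.1) || (j \in P.2)].

(** For a cover [(X, Y)] of least size, Hall's condition holds from [X] into the complement of [Y]
    and from [Y] into the complement of [X], since a violating set could be exchanged for its
    smaller neighbourhood. The two matchings are disjoint and together as large as the cover. *)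
Lemma koenig (I J : finType) (R : I -> J -> bool) :
  exists (s : seq (I * J)) (P : {set I} * {set J}),
    [/\ is_matching R s, is_cover R P & size s = #|P.1| + #|P.2|].
Proof.
have cT : is_cover R (setT, setT) by apply/forallP=> i; apply/forallP=> j; rewrite !inE implybT.
case: (arg_minnP (fun P : {set I} * {set J} => #|P.1| + #|P.2|) cT) => -[X Y] /= covP minP.
have cov i j : R i j -> (i \in X) || (j \in Y).
  by move/forallP: covP => /(_ i) /forallP /(_ j) /implyP.
have [S SX|s [/and3P[us1 us2 Rs] fs ss]] := @hall_seq I J R X (~: Y).
  have /minP /= : is_cover R (X :\: S, Y :|: nbhd R (~: Y) S).
    apply/forallP=> i; apply/forallP=> j; apply/implyP=> Rij /=.
    rewrite !inE; case/orP: (cov _ _ Rij) => [iX|->]; last by rewrite orbT.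
    case: (boolP (i \in S)) => iS /=; last by rewrite iX.
    case: (boolP (j \in Y)) => jY //=.
    by apply/exists_inP; exists i.
  rewrite cardsD (setIidPr SX).
  have := subset_leq_card SX.
  have : #|Y :|: nbhd R (~: Y) S| <= #|Y| + #|nbhd R (~: Y) S| by rewrite cardsU leq_subr.
  lia.
have [S SY|t [/and3P[ut1 ut2 Rt] ft st]] := @hall_seq J I (fun j i => R i j) Y (~: X).
  have /minP /= : is_cover R (X :|: nbhd (fun j i => R i j) (~: X) S, Y :\: S).
    apply/forallP=> i; apply/forallP=> j; apply/implyP=> Rij /=.
    rewrite !inE; case/orP: (cov _ _ Rij) => [->//|jY].
    case: (boolP (j \in S)) => jS /=; last by rewrite jY orbT.
    case: (boolP (i \in X)) => //= iX; rewrite ?orbF.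
    by apply/exists_inP; exists j.
  rewrite cardsD (setIidPr SY).
  have := subset_leq_card SY.
  set n := nbhd _ _ _.
  have : #|X :|: n| <= #|X| + #|n| by rewrite cardsU leq_subr.
  lia.
exists (s ++ [seq (p.2, p.1) | p <- t]), (X, Y); split=> //=; last first.
  by rewrite size_cat size_map -(size_map fst s) -(size_map fst t) fs ft -!cardE.
rewrite /is_matching !map_cat -!map_comp !cat_uniq all_cat Rs all_map us1 us2 /=.
rewrite (eq_map (g := snd))// ut2 (eq_map (g := fst) (f := _ \o _))// ut1 !andbT.
apply/and3P; split=> //; apply/hasPn => z.
  by move/st; rewrite inE fs mem_enum.
by rewrite ft mem_enum => zY; apply/negP => /ss; rewrite inE zY.
Qed.

(** * The cluster problem *)

Section OneSide.
Variables (U C L : finType).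
Implicit Types (A : {set U}) (D : {set C}) (la : C -> U -> L) (X : C -> {set U}).
Definition labelled A la c l := [set u in A | la c u == l].
Definition block A la X c l := [set u in A | (u \in X c) && (la c u == l)].
(** This is the set [T_u] of the overview, and [once] below is [A1_c]. *)
Definition covering D X u := [set c in D | u \in X c].
Definition once A D X c := [set u in A | covering D X u == [set c]].

Lemma block_sub A la X c l : block A la X c l \subset labelled A la c l.
Proof. by apply/subsetP => u; rewrite !inE => /and3P[-> _ ->]. Qed.

Lemma once_cover A D X c u : u \in once A D X c ->
  [/\ u \in A, u \in X c & forall c', c' \in D -> u \in X c' -> c' = c].
Proof.
rewrite inE => /andP[-> /eqP e]; split=> //.
  by have := set11 c; rewrite -e inE => /andP[].
by move=> c' c'D uX; apply/set1P; rewrite -e inE c'D.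
Qed.

Lemma once_notin A D X c c' u : u \in once A D X c -> c' \in D -> c' != c -> u \notin X c'.
Proof. by case/once_cover=> _ _ h c'D; apply: contraNN => /(h _ c'D) ->. Qed.

Lemma sum_labelled A la c : \sum_l #|labelled A la c l| = #|A|.
Proof.
rewrite -sum1_card (partition_big (la c) xpredT)//=.
by apply: eq_bigr => l _; rewrite -sum1_card; apply: eq_bigl => u; rewrite inE.
Qed.

Lemma sum_block A la X c : \sum_l #|block A la X c l| = #|A :&: X c|.
Proof.
rewrite -sum1_card (partition_big (la c) xpredT)//=.
apply: eq_bigr => l _; rewrite -sum1_card; apply: eq_bigl => u.
by rewrite !inE andbA.
Qed.

Lemma disjoint_labels A la c (ls : seq L) : uniq ls ->
  \sum_(l <- ls) #|labelled A la c l| <= #|A|.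
Proof.
move=> uls; rewrite -(sum_labelled A la c) big_uniq //= [leqRHS](bigID (mem ls)) /=.
by rewrite leq_addr.
Qed.

(** A vertex [u] of [A] contributes the size of its non-empty [covering] set, and one more if that
    size is 1: at least 2 in all. *)
Lemma sum_once A D X :
  (forall u, u \in A -> covering D X u != set0) ->
  2 * #|A| <= \sum_(c in D) (#|A :&: X c| + #|once A D X c|).
Proof.
move=> ne; rewrite big_split /=.
have -> : \sum_(c in D) #|A :&: X c| = \sum_(u in A) #|covering D X u|.
  under eq_bigr do rewrite -sum1_card.
  under [RHS]eq_bigr do rewrite -sum1_card.
  rewrite (exchange_big_dep (mem A)) /=; last by move=> c u _; rewrite inE => /andP[].
  by apply: eq_bigr => u uA; apply: eq_bigl => c; rewrite !inE uA.
have -> : \sum_(c in D) #|once A D X c| = \sum_(u in A) (#|covering D X u| == 1).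
  under eq_bigr do rewrite -sum1_card.
  rewrite (exchange_big_dep (mem A)) /=; last by move=> c u _; rewrite inE => /andP[].
  apply: eq_bigr => u uA.
  case: cards1P => [[c e]|ne1]; last first.
    rewrite big_pred0// => c; apply/negbTE; rewrite inE uA /=.
    by apply/negP => /andP[_ /eqP e]; apply: ne1; exists c.
  rewrite (big_pred1 c)// => c'; rewrite inE uA e /=.
  apply/andP/eqP => [[_ /eqP/esym/set1_inj]//|->].
  by rewrite eqxx; split=> //; have := set11 c; rewrite -e inE => /andP[].
rewrite -big_split /= -sum1_card big_distrr /=; apply: leq_sum => u /ne.
by rewrite -card_gt0; case: #|_| => [|[|n]].
Qed.

End OneSide.

(* [la c] and [lb c] name the component of colour [c] of a vertex, [X c] and    *)
(* [Y c] are the parts of the covers of these components on the two sides.      *)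
Record cfg (U V C L : finType) (col : U -> V -> option C) (la : C -> U -> L)
    (lb : C -> V -> L) (X : C -> {set U}) (Y : C -> {set V}) (s h : nat)
    (A : {set U}) (B : {set V}) (D : {set C}) : Prop := Cfg {
  cfg_lab : forall u v c, u \in A -> v \in B -> col u v = Some c -> la c u = lb c v;
  cfg_cov : forall u v c, u \in A -> v \in B -> col u v = Some c ->
    (u \in X c) || (v \in Y c);
  cfg_size : forall c l, #|block A la X c l| + #|block B lb Y c l| <= s;
  cfg_col : forall u v c, u \in A -> v \in B -> col u v = Some c -> c \in D;
  cfg_missA : forall u, u \in A -> #|[set v in B | col u v == None]| <= h;
  cfg_missB : forall v, v \in B -> #|[set u in A | col u v == None]| <= h }.

Lemma cfg_swap U V C L col la lb X Y s h A B D :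
  @cfg U V C L col la lb X Y s h A B D -> cfg (fun v u => col u v) lb la Y X s h B A D.
Proof.
case=> h1 h2 h3 h4 h5 h6; split=> //.
- by move=> v u c vB uA /h1 ->.
- by move=> v u c vB uA /h2; rewrite orbC => ->.
- by move=> c l; rewrite addnC.
- by move=> v u c vB uA /h4 ->.
Qed.

Lemma cfg_sub (U V C L : finType) col la lb X Y s h (A A' : {set U}) (B B' : {set V}) (D D' :
  {set C}) :
  @cfg U V C L col la lb X Y s h A B D -> A' \subset A -> B' \subset B ->
  (forall u v c, u \in A' -> v \in B' -> col u v = Some c -> c \in D') ->
  cfg col la lb X Y s h A' B' D'.
Proof.
case=> h1 h2 h3 h4 h5 h6 sA sB hD; split=> //.
- by move=> u v c /(subsetP sA) uA /(subsetP sB); apply: h1.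
- by move=> u v c /(subsetP sA) uA /(subsetP sB); apply: h2.
- move=> c l; apply: leq_trans (h3 c l); apply: leq_add; apply: subset_leq_card.
    by apply/subsetP => u; rewrite !inE => /andP[/(subsetP sA) ->].
  by apply/subsetP => u; rewrite !inE => /andP[/(subsetP sB) ->].
- move=> u /(subsetP sA) /h5; apply: leq_trans; apply: subset_leq_card.
  by apply/subsetP => v; rewrite !inE => /andP[/(subsetP sB) ->].
- move=> v /(subsetP sB) /h6; apply: leq_trans; apply: subset_leq_card.
  by apply/subsetP => u; rewrite !inE => /andP[/(subsetP sA) ->].
Qed.

(* A component of colour c whose cover is balanced has at most                  *)
(* s (|A_l \ X| + |B_l \ Y|) edges; a component that is too small for this can  *)
(* be covered by its whole left side instead.                                   *)
Definition balanced (U V C L : finType) (la : C -> U -> L) (lb : C -> V -> L)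
    X Y (A : {set U}) (B : {set V}) c l :=
  let x := #|block A la X c l| in let y := #|block B lb Y c l| in
  [|| x + y <= #|labelled A la c l|, x + y <= #|labelled B lb c l|, x == 0 | y == 0].

Lemma cfg_balance U V C L col la lb X Y s h A B D :
  @cfg U V C L col la lb X Y s h A B D ->
  exists X' Y', cfg col la lb X' Y' s h A B D /\ forall c l, balanced la lb X' Y' A B c l.
Proof.
case=> h1 h2 h3 h4 h5 h6; pose b := balanced la lb X Y A B.
pose X' c := [set u | b c (la c u) ==> (u \in X c)].
pose Y' c := [set v | b c (lb c v) && (v \in Y c)].
have eX c l : block A la X' c l = if b c l then block A la X c l else labelled A la c l.
  apply/setP=> u; rewrite !inE; case: (boolP (b c l)) => bcl; rewrite !inE;
  by case: (eqVneq (la c u)) => [->|]; rewrite ?andbF ?bcl ?(negbTE bcl).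
have eY c l : block B lb Y' c l = if b c l then block B lb Y c l else set0.
  apply/setP=> u; rewrite !inE; case: (boolP (b c l)) => bcl; rewrite !inE;
  by case: (eqVneq (lb c u)) => [->|]; rewrite ?andbF ?bcl ?(negbTE bcl) ?andbF.
exists X', Y'; split; first split=> //.
- move=> u v c uA vB e; rewrite !inE (h1 _ _ _ uA vB e).
  by case: (b _ _) => //=; apply: h2.
(* An unbalanced component has fewer left vertices than its cover has elements, so its whole left
   part is again a cover of size at most [s]. *)
- move=> c l; rewrite eX eY; case: (boolP (b c l)) => // nb; rewrite cards0 addn0.
  move: nb; rewrite /b /balanced !negb_or => /and3P[+ _ _].
  rewrite -ltnNge => /ltnW /leq_trans; apply; exact: h3.
- move=> c l; rewrite /balanced eX eY; case: (boolP (b c l)) => // _.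
  by rewrite cards0 eqxx !orbT.
Qed.

(** * Degrees, components and vertices covered by one colour only *)

Section Cfg.
Variables (U V C L : finType) (col : U -> V -> option C) (la : C -> U -> L)
    (lb : C -> V -> L) (X : C -> {set U}) (Y : C -> {set V}) (s h : nat)
    (A : {set U}) (B : {set V}) (D : {set C}).
Hypothesis K : cfg col la lb X Y s h A B D.

Local Notation Xb := (block A la X).
Local Notation Yb := (block B lb Y).
Local Notation A1 := (once A D X).
Local Notation B1 := (once B D Y).

Definition cnbr c u := [set v in B | col u v == Some c].

Lemma cnbr_label c u : u \in A -> cnbr c u \subset labelled B lb c (la c u).
Proof.
move=> uA; apply/subsetP => v; rewrite !inE => /andP[vB /eqP e].
by rewrite vB (cfg_lab K uA vB e) /=.
Qed.

Lemma cnbr_block c u : u \in A -> u \notin X c -> cnbr c u \subset Yb c (la c u).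
Proof.
move=> uA uX; apply/subsetP => v; rewrite !inE => /andP[vB /eqP e].
rewrite vB (cfg_lab K uA vB e) eqxx andbT /=.
by have := cfg_cov K uA vB e; rewrite (negbTE uX).
Qed.

Lemma block_le c l : #|Yb c l| <= s.
Proof. exact: leq_trans (leq_addl _ _) (cfg_size K c l). Qed.

Lemma blockA_le c l : #|Xb c l| <= s.
Proof. exact: leq_trans (leq_addr _ _) (cfg_size K c l). Qed.

Lemma card_cnbr c u : u \in A -> u \notin X c -> #|cnbr c u| <= s.
Proof.
by move=> uA uX; rewrite (leq_trans (subset_leq_card (cnbr_block uA uX)))// block_le.
Qed.

Lemma degree_sum u : u \in A -> #|B| <= h + \sum_(c in D) #|cnbr c u|.
Proof.
move=> uA; have := cfg_missA K uA.
have : B \subset [set v in B | col u v == None] :|: \bigcup_(c in D) cnbr c u.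
  apply/subsetP => v vB; rewrite !inE vB /=; case E : (col u v) => [c|] //=.
  by apply/bigcupP; exists c; [exact: (cfg_col K uA vB E)|rewrite inE vB E eqxx].
move/subset_leq_card.
have : #|\bigcup_(c in D) cnbr c u| <= \sum_(c in D) #|cnbr c u|.
  elim/big_rec2: _ => [|c S n _ le]; first by rewrite cards0.
  by rewrite cardsU (leq_trans (leq_subr _ _))// leq_add2l.
rewrite cardsU; lia.
Qed.

(** A vertex outside the cover of a colour has all its neighbours of that colour in one block of the
    other side, hence at most [s] of them. *)
Lemma covering_neq0 u : u \in A -> h + #|D| * s < #|B| -> covering D X u != set0.
Proof.
move=> uA lt; apply/eqP => e.
have := degree_sum uA; have : \sum_(c in D) #|cnbr c u| <= \sum_(c in D) s.
  apply: leq_sum => c cD; apply: card_cnbr => //.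
  by apply/negP => uX; have := in_set0 c; rewrite -e inE cD uX.
rewrite sum_nat_const; lia.
Qed.

(** In each colour other than [c] the vertex has at most [s] neighbours, so the remaining ones must
    all lie in its component of colour [c]. *)
Lemma once_degree c u : c \in D -> u \in A1 c ->
  #|B| <= h + #|labelled B lb c (la c u)| + #|D|.-1 * s.
Proof.
move=> cD uc; have [uA _ _] := once_cover uc.
have := degree_sum uA; rewrite (bigD1 c)//=.
have := subset_leq_card (cnbr_label c uA).
have : \sum_(c' in D | c' != c) #|cnbr c' u| <= \sum_(c' in D | c' != c) s.
  apply: leq_sum => c' /andP[c'D c'c]; apply: card_cnbr => //.
  exact: (once_notin uc).
have -> : \sum_(c' in D | c' != c) s = #|D|.-1 * s.
  have -> : #|D|.-1 = #|D :\ c| by rewrite (cardsD1 c D) cD.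
  by rewrite -sum_nat_const; apply: eq_bigl => c'; rewrite !inE andbC.
lia.
Qed.

(** One end of the edge lies in the cover for the colour of the edge, but both ends are covered by
    [c] only; so the edge has colour [c]. *)
Lemma once_once c u v : c \in D -> u \in A1 c -> v \in B1 c -> col u v != None ->
  la c u = lb c v.
Proof.
move=> cD uc vc; have [uA _ hu] := once_cover uc; have [vB _ hv] := once_cover vc.
case E : (col u v) => [c'|] // _; have c'D := cfg_col K uA vB E.
suff e : c' = c by rewrite -e; exact: (cfg_lab K uA vB E).
by case/orP: (cfg_cov K uA vB E) => /[dup]; [move=> _ /hu|move=> _ /hv]; apply.
Qed.

Lemma common_nbr (A' : {set U}) v v' : A' \subset A -> v \in B -> v' \in B ->
  2 * h < #|A'| -> exists u, [/\ u \in A', col u v != None & col u v' != None].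
Proof.
move=> sA vB v'B lt.
have [e|[u]] := set_0Vmem (A' :\: ([set u in A | col u v == None] :|: [set u in A | col u v' == None])).
  have : #|A'| <= #|[set u in A | col u v == None] :|: [set u in A | col u v' == None]|.
    by apply: subset_leq_card; rewrite -setD_eq0 e.
  rewrite cardsU; have := cfg_missB K vB; have := cfg_missB K v'B; lia.
rewrite !inE negb_or !negb_and => /andP[/andP[h1 h2] uA'].
by exists u; rewrite uA'; move: h1 h2; rewrite (subsetP sA _ uA').
Qed.

(** Any two vertices of [B1 c] have a common neighbour in [A1 c], so by [once_once] both sets lie in
    a single component, and hence in its cover. *)
Lemma once_both c : c \in D -> 2 * h < #|A1 c| -> 2 * h < #|B1 c| ->
  #|A1 c| + #|B1 c| <= s.
Proof.
move=> cD ltA ltB.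
have sA1 : A1 c \subset A by apply/subsetP => u /once_cover[].
have [v0 v0B1] : exists v, v \in B1 c by apply/card_gt0P; lia.
have [v0B _ _] := once_cover v0B1.
have hB v : v \in B1 c -> lb c v = lb c v0.
  move=> vB1; have [vB _ _] := once_cover vB1.
  have [u [uA1 uv uv0]] := common_nbr sA1 vB v0B ltA.
  by rewrite -(once_once cD uA1 vB1)// (once_once cD uA1 v0B1).
have hA u : u \in A1 c -> la c u = lb c v0.
  move=> uA1; have [uA _ _] := once_cover uA1.
  have [e|[v]] := set_0Vmem (B1 c :\: [set v in B | col u v == None]).
    have : #|B1 c| <= #|[set v in B | col u v == None]|.
      by apply: subset_leq_card; rewrite -setD_eq0 e.
    have := cfg_missA K uA; lia.
  rewrite in_setD => /andP[+ vB1]; have [vB _ _] := once_cover vB1.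
  by rewrite inE vB /= => uv; rewrite (once_once cD uA1 vB1) ?hB.
apply: leq_trans (cfg_size K c (lb c v0)); apply: leq_add; apply: subset_leq_card.
  apply/subsetP => u uA1; have [uA uX _] := once_cover uA1.
  by rewrite inE uA uX hA /=.
apply/subsetP => v vB1; have [vB vY _] := once_cover vB1.
by rewrite inE vB vY hB /=.
Qed.

(** More than [s] vertices do not fit into the cover of one component, and by [once_degree] three
    components would each contain more than a third of [B]. *)
Lemma two_labels c : c \in D -> s < #|A1 c| -> 3 * h + 3 * (#|D|.-1 * s) < 2 * #|B| ->
  exists u1 u2, [/\ u1 \in A1 c, u2 \in A1 c, la c u1 != la c u2 &
    forall u, u \in A1 c -> (la c u == la c u1) || (la c u == la c u2)].
Proof.
move=> cD lt ltB.
have [u1 u1A1] : exists u, u \in A1 c by apply/card_gt0P; lia.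
have [/forall_inP h1|] := boolP [forall u in A1 c, la c u == la c u1].
  have : A1 c \subset Xb c (la c u1).
    apply/subsetP => u uA1; have [uA uX _] := once_cover uA1.
    by rewrite inE uA uX h1.
  move/subset_leq_card; have := blockA_le c (la c u1); lia.
rewrite negb_forall_in => /exists_inP[u2 u2A1 ne].
exists u1, u2; split=> //; first by rewrite eq_sym.
move=> u uA1; apply/negPn; rewrite negb_or; apply/negP => /andP[ne1 ne2].
have := @disjoint_labels _ _ _ B lb c [:: la c u1; la c u2; la c u].
rewrite /= !inE negb_or ![la c u1 == _]eq_sym ![la c u2 == la c u]eq_sym ne ne1 ne2 /=.
rewrite !big_cons big_nil => /(_ isT).
have := once_degree cD u1A1; have := once_degree cD u2A1; have := once_degree cD uA1.
lia.
Qed.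

(** A component with sides [a], [b] and blocks [x], [y] has at most [x * b + (a - x) * y] edges.
    This is at most [(x + y) * ((a - x) + (b - y))] when [x * y <= x * (a - x) + y * (b - y)], which
    each case of [balanced] ensures. *)
Lemma count_colour c : (forall l, balanced la lb X Y A B c l) ->
  \sum_(u in A) #|cnbr c u| <= s * (#|A :\: X c| + #|B :\: Y c|).
Proof.
move=> bal; rewrite (partition_big (la c) xpredT)//= !cardsD.
rewrite -(sum_labelled A la c) -(sum_labelled B lb c) -(sum_block A la X c) -(sum_block B lb Y c).
rewrite -!sumnB; try by move=> l _; rewrite subset_leq_card// block_sub.
rewrite -big_split /= big_distrr /=; apply: leq_sum => l _.
set x := #|Xb c l|; set y := #|Yb c l|; set a := #|labelled A la c l|;
  set b := #|labelled B lb c l|.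
have lexa : x <= a by apply/subset_leq_card/block_sub.
have leyb : y <= b by apply/subset_leq_card/block_sub.
have lexy : x + y <= s by apply: (cfg_size K).
have : \sum_(u in A | la c u == l) #|cnbr c u| <= x * b + (a - x) * y.
  rewrite (bigID (mem (X c))) /=; apply: leq_add.
    rewrite (eq_bigl (fun u => u \in Xb c l)); last by move=> u; rewrite !inE andbAC andbA.
    rewrite -sum_nat_const; apply: leq_sum => u; rewrite inE => /and3P[uA _ /eqP e].
    by rewrite /b -e; apply/subset_leq_card/cnbr_label.
  rewrite (eq_bigl (fun u => u \in labelled A la c l :\: Xb c l)); last first.
    by move=> u; rewrite !inE; case: (u \in A); case: (la c u == l); rewrite ?andbF ?andbT //=.
  have -> : a - x = #|labelled A la c l :\: Xb c l|.
    by rewrite cardsD (setIidPr (block_sub _ _ _ _ _)).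
  rewrite -sum_nat_const; apply: leq_sum => u; rewrite !inE => /andP[+ /andP[uA /eqP e]].
  rewrite uA e eqxx andbT /= => uX; rewrite /y -e.
  by apply/subset_leq_card/cnbr_block.
move/leq_trans; apply; have := bal l; rewrite /balanced -/x -/y -/a -/b.
by case/or4P => [||/eqP e|/eqP e]; nia.
Qed.

End Cfg.

Section Count.
Variables (U V C L : finType) (col : U -> V -> option C) (la : C -> U -> L)
    (lb : C -> V -> L) (X : C -> {set U}) (Y : C -> {set V}) (s h : nat)
    (A : {set U}) (B : {set V}) (D : {set C}).
Hypothesis K : cfg col la lb X Y s h A B D.

Local Notation Xb := (block A la X).
Local Notation Yb := (block B lb Y).
Local Notation A1 := (once A D X).
Local Notation B1 := (once B D Y).

(** All but [h * #|A|] pairs are edges, and [count_colour] bounds the edges through the numbers of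
    uncovered vertices. By [sum_once], these numbers can be large only if many vertices are covered
    exactly once. *)
Lemma count_once : (forall c l, balanced la lb X Y A B c l) ->
  h + #|D| * s < #|B| -> h + #|D| * s < #|A| ->
  #|A| * #|B| + 2 * s * (#|A| + #|B|) <=
  h * #|A| + s * (#|D| * (#|A| + #|B|)) + s * \sum_(c in D) (#|A1 c| + #|B1 c|).
Proof.
move=> bal ltB ltA.
have nA u : u \in A -> covering D X u != set0 by move=> uA; apply: (covering_neq0 K).
have nB v : v \in B -> covering D Y v != set0.
  by move=> vB; apply: (covering_neq0 (cfg_swap K)).
have := sum_once nA; have := sum_once nB.
have : #|A| * #|B| <= \sum_(u in A) (h + \sum_(c in D) #|cnbr col B c u|).
  by rewrite -sum_nat_const; apply: leq_sum => u; apply: (degree_sum K).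
rewrite big_split /= sum_nat_const exchange_big /=.
have : \sum_(c in D) \sum_(u in A) #|cnbr col B c u| <= \sum_(c in D) s * (#|A :\: X c| + #|B :\: Y c|).
  by apply: leq_sum => c _; apply: (count_colour K).
rewrite -big_distrr /= big_split /=.
have cD (T : finType) (S : {set T}) (Z : C -> {set T}) :
    \sum_(c in D) #|S :\: Z c| + \sum_(c in D) #|S :&: Z c| = #|D| * #|S|.
  rewrite -big_split -sum_nat_const /=; apply: eq_bigr => c _.
  by rewrite addnC cardsID.
have := cD _ A X; have := cD _ B Y; rewrite !big_split /=; nia.
Qed.

End Count.

(** * Deleting a colour; comparing blocks when three colours remain *)

Section Rich.
Variables (U V C L : finType) (col : U -> V -> option C) (la : C -> U -> L)
    (lb : C -> V -> L) (X : C -> {set U}) (Y : C -> {set V}) (s h : nat)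
    (A : {set U}) (B : {set V}) (D : {set C}).
Hypothesis K : cfg col la lb X Y s h A B D.

Local Notation Xb := (block A la X).
Local Notation Yb := (block B lb Y).
Local Notation A1 := (once A D X).
Local Notation B1 := (once B D Y).

Lemma once_dichotomy c : c \in D -> s + 4 * h < #|A1 c| + #|B1 c| ->
  s + 2 * h < #|A1 c| /\ #|B1 c| <= 2 * h \/ s + 2 * h < #|B1 c| /\ #|A1 c| <= 2 * h.
Proof.
move=> cD lt; case: (leqP #|A1 c| (2 * h)) => leA; first by right; split=> //; lia.
case: (leqP #|B1 c| (2 * h)) => leB; first by left; split=> //; lia.
by have := once_both K cD leA leB; lia.
Qed.

Lemma once_sub_blocks c l1 l2 :
  (forall u, u \in A1 c -> (la c u == l1) || (la c u == l2)) ->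
  #|A1 c| <= #|Xb c l1| + #|Xb c l2|.
Proof.
move=> hl; rewrite -cardsUI (leq_trans _ (leq_addr _ _))// subset_leq_card//.
apply/subsetP => u uA1; have [uA uX _] := once_cover uA1.
by rewrite !inE uA uX /= hl.
Qed.

(** On the left the covers of the two components met by [A1 c] are removed; the right is restricted
    to these components minus their covers. An edge of colour [c] would then be uncovered. The [x]
    vertices lost on the left reappear as a gain on the right, because the two blocks of a component
    together have size at most [s]. *)
Lemma delete_colour c : c \in D -> s < #|A1 c| ->
  3 * h + 3 * (#|D|.-1 * s) < 2 * #|B| ->
  exists A' B' x, [/\ cfg col la lb X Y s h A' B' (D :\ c), s <= x <= 2 * s,
    #|A| <= #|A'| + x & 2 * #|B| + x <= #|B'| + 2 * h + 2 * (#|D|.-1 * s) + 2 * s].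
Proof.
move=> cD lt ltB; have [u1 [u2 [u1A1 u2A1 ne hl]]] := two_labels K cD lt ltB.
set l1 := la c u1 in ne hl; set l2 := la c u2 in ne hl.
pose A' := A :\: (Xb c l1 :|: Xb c l2).
pose B' := (labelled B lb c l1 :\: Yb c l1) :|: (labelled B lb c l2 :\: Yb c l2).
exists A', B', (#|Xb c l1| + #|Xb c l2|); split.
- apply: (cfg_sub K); first exact: subsetDl.
    by apply/subsetP => v; rewrite !inE => /orP[] /andP[_ /andP[->]].
  move=> u v c' uA' vB' e.
  have uA : u \in A by move: uA'; rewrite inE => /andP[].
  have vB : v \in B by move: vB'; rewrite !inE => /orP[] /andP[_ /andP[->]].
  rewrite !inE (cfg_col K uA vB e) andbT; apply/eqP => ec; subst c'.
  have := cfg_cov K uA vB e; have := cfg_lab K uA vB e.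
  move=> el; move: uA' vB'; rewrite !inE uA vB /= el.
  by case: (u \in X c) => /=; case: (v \in Y c) => /=; case: (lb c v == l1); case: (lb c v == l2).
- have := once_sub_blocks hl; have := blockA_le K c l1; have := blockA_le K c l2; lia.
- rewrite cardsD; have : #|Xb c l1 :|: Xb c l2| <= #|Xb c l1| + #|Xb c l2|.
    by rewrite cardsU leq_subr.
  have := subset_leq_card (subsetIr A (Xb c l1 :|: Xb c l2)).
  lia.
- have := once_degree K cD u1A1; have := once_degree K cD u2A1.
  have := cfg_size K c l1; have := cfg_size K c l2.
  have -> : #|B'| = #|labelled B lb c l1 :\: Yb c l1| + #|labelled B lb c l2 :\: Yb c l2|.
    rewrite cardsU.
    suff -> : (labelled B lb c l1 :\: Yb c l1) :&: (labelled B lb c l2 :\: Yb c l2) = set0.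
      by rewrite cards0 subn0.
    apply/setP => v; rewrite !inE; case: (eqVneq (lb c v) l1) => [->|]; rewrite ?andbF //.
    by rewrite (negbTE ne) !andbF.
  rewrite !cardsD !(setIidPr (block_sub _ _ _ _ _)) -/l1 -/l2.
  have := subset_leq_card (block_sub B lb Y c l1); have := subset_leq_card (block_sub B lb Y c l2).
  lia.
Qed.

Definition three c1 c2 c3 :=
  [/\ c1 \in D, c2 \in D, c3 \in D, uniq [:: c1; c2; c3] & D \subset [:: c1; c2; c3]].

(* A right vertex outside the component of [u1] in colour [c1] sees [u1] in     *)
(* colour [c2] or [c3], hence from inside the cover; likewise for [u2].  The    *)
(* four blocks are almost disjoint and almost full, leaving little room for     *)
(* the left parts of the covers of their components.                            *)
Lemma four_blocks c1 c2 c3 u1 u2 : three c1 c2 c3 -> u1 \in A1 c1 -> u2 \in A1 c1 ->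
  la c1 u1 != la c1 u2 -> 3 * s + 2 * h < #|B| ->
  let x c u := #|Xb c (la c u)| in
  [/\ la c2 u1 != la c2 u2,
     #|B| <= 2 * h + #|Yb c2 (la c2 u1)| + #|Yb c2 (la c2 u2)| +
       #|Yb c3 (la c3 u1)| + #|Yb c3 (la c3 u2)| &
     x c2 u1 + x c2 u2 + x c3 u1 + x c3 u2 + #|B| <= 4 * s + 2 * h].
Proof.
move=> [c1D c2D c3D + /subsetP sD] u1A1 u2A1 ne ltB x.
rewrite /= !inE negb_or andbT => /andP[/andP[n12 n13] n23].
have [u1A _ _] := once_cover u1A1; have [u2A _ _] := once_cover u2A1.
pose miss u := [set v in B | col u v == None].
pose Q c := Yb c (la c u1) :|: Yb c (la c u2).
have sub u v : u \in A1 c1 -> v \in B -> v \notin miss u -> lb c1 v != la c1 u ->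
    v \in Yb c2 (la c2 u) :|: Yb c3 (la c3 u).
  move=> uA1 vB; have [uA _ _] := once_cover uA1.
  rewrite inE vB /=; case E : (col u v) => [c|] // _ nl.
  have := sD _ (cfg_col K uA vB E); rewrite !inE => /or3P[] /eqP e; subst c.
  - by move: nl; rewrite (cfg_lab K uA vB E) eqxx.
  - have /subsetP /(_ v) : cnbr col B c2 u \subset Yb c2 (la c2 u).
      by apply: (cnbr_block K) => //; apply: once_notin uA1 _ _; rewrite // eq_sym.
    by rewrite !inE vB E eqxx => ->.
  - have /subsetP /(_ v) : cnbr col B c3 u \subset Yb c3 (la c3 u).
      by apply: (cnbr_block K) => //; apply: once_notin uA1 _ _; rewrite // eq_sym.
    by rewrite !inE vB E eqxx => ->; rewrite ?orbT.
have cover : B \subset (miss u1 :|: miss u2) :|: (Q c2 :|: Q c3).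
  apply/subsetP => v vB.
  case: (boolP (v \in miss u1)) => m1; first by rewrite !in_setU m1.
  case: (boolP (v \in miss u2)) => m2; first by rewrite !in_setU m2 orbT.
  rewrite /Q !(in_setU v); case: (eqVneq (lb c1 v) (la c1 u1)) => [e|nl].
    have := sub _ _ u2A1 vB m2; rewrite e in_setU => /(_ ne) /orP[] ->; rewrite ?orbT //.
  by have := sub _ _ u1A1 vB m1 nl; rewrite in_setU => /orP[] ->; rewrite ?orbT.
have cU (S S' : {set V}) : #|S :|: S'| <= #|S| + #|S'| by rewrite cardsU leq_subr.
have cov4 : #|B| <= 2 * h + #|Q c2| + #|Q c3|.
  have := subset_leq_card cover; have := cU (miss u1 :|: miss u2) (Q c2 :|: Q c3).
  have := cU (miss u1) (miss u2); have := cU (Q c2) (Q c3).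
  have : #|miss u1| <= h := cfg_missA K u1A; have : #|miss u2| <= h := cfg_missA K u2A.
  card_lia.
have yle := block_le K.
have Q2 : #|Q c2| <= #|Yb c2 (la c2 u1)| + #|Yb c2 (la c2 u2)| := cU _ _.
have Q3 : #|Q c3| <= #|Yb c3 (la c3 u1)| + #|Yb c3 (la c3 u2)| := cU _ _.
clear sub cover cU miss sD.
have ne2 : la c2 u1 != la c2 u2.
  apply/eqP => e; have := yle c3 (la c3 u1); have := yle c3 (la c3 u2).
  have : #|Q c2| <= s by rewrite /Q e setUid.
  move: Q2 Q3 cov4 ltB; card_lia.
have ne3 : la c3 u1 != la c3 u2.
  apply/eqP => e; have := yle c2 (la c2 u1); have := yle c2 (la c2 u2).
  have : #|Q c3| <= s by rewrite /Q e setUid.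
  move: Q2 Q3 cov4 ltB; card_lia.
split=> //.
  move: Q2 Q3 cov4; card_lia.
move: Q2 Q3 cov4 (cfg_size K c2 (la c2 u1)) (cfg_size K c2 (la c2 u2)).
move: (cfg_size K c3 (la c3 u1)) (cfg_size K c3 (la c3 u2)); rewrite /x; card_lia.
Qed.

(** Some [w] shares its component of colour [c2] with some [u], and the block of the other [w] has
    size at most [s]. Otherwise there are four disjoint parts of [B], two large by [once_degree] and
    two containing blocks from [four_blocks], of total size exceeding [#|B|]. *)
Lemma once_pair_bound c1 c2 c3 u1 u2 w1 w2 : three c1 c2 c3 -> u1 \in A1 c1 -> u2 \in A1 c1 ->
  la c1 u1 != la c1 u2 -> w1 \in A1 c2 -> w2 \in A1 c2 -> la c2 w1 != la c2 w2 ->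
  #|D| = 3 -> 3 * s + 2 * h < #|B| ->
  #|Xb c2 (la c2 w1)| + #|Xb c2 (la c2 w2)| <=
  s + #|Xb c2 (la c2 u1)| + #|Xb c2 (la c2 u2)|.
Proof.
move=> t u1A1 u2A1 ne w1A1 w2A1 new D3 ltB.
have c2D : c2 \in D by case: t.
have [ne2 yB _] := four_blocks t u1A1 u2A1 ne ltB.
have x1 := blockA_le K c2 (la c2 w1); have x2 := blockA_le K c2 (la c2 w2).
case: (eqVneq (la c2 w1) (la c2 u1)) => [e|n1]; first by move: x1 x2; rewrite e; card_lia.
case: (eqVneq (la c2 w1) (la c2 u2)) => [e|n2]; first by move: x1 x2; rewrite e; card_lia.
case: (eqVneq (la c2 w2) (la c2 u1)) => [e|n3]; first by move: x1 x2; rewrite e; card_lia.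
case: (eqVneq (la c2 w2) (la c2 u2)) => [e|n4]; first by move: x1 x2; rewrite e; card_lia.
have := @disjoint_labels _ _ _ B lb c2 [:: la c2 w1; la c2 w2; la c2 u1; la c2 u2].
rewrite /= !inE !negb_or new n1 n2 n3 n4 ne2 /= !big_cons big_nil => /(_ isT).
have := once_degree K c2D w1A1; have := once_degree K c2D w2A1; rewrite D3.
have := subset_leq_card (block_sub B lb Y c2 (la c2 u1)).
have := subset_leq_card (block_sub B lb Y c2 (la c2 u2)).
move: yB ltB (block_le K c3 (la c3 u1)) (block_le K c3 (la c3 u2)); card_lia.
Qed.

(** [A1 c1] contributes at most [2 * s]. The sets [A1 c2] and [A1 c3] lie in pairs of blocks that
    exceed those at [u1], [u2] by at most [s] each, and [four_blocks] bounds the latter. *)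
Lemma richAAA c1 c2 c3 : three c1 c2 c3 -> #|D| = 3 -> 3 * s + 2 * h < #|B| ->
  s < #|A1 c1| -> s < #|A1 c2| -> s < #|A1 c3| ->
  #|A1 c1| + #|A1 c2| + #|A1 c3| + #|B| <= 8 * s + 2 * h.
Proof.
move=> t D3 ltB r1 r2 r3; have [c1D c2D c3D un sD] := t.
have t' : three c1 c3 c2.
  split=> //; first by rewrite -(perm_uniq (s1 := [:: c1; c2;
    c3]))// perm_cons (perm_catC [:: c2] [:: c3]).
  by apply: subset_trans sD _; apply/subsetP => c; rewrite !inE [X in _ || X]orbC.
have ltB2 : 3 * h + 3 * (#|D|.-1 * s) < 2 * #|B| by rewrite D3; lia.
have [u1 [u2 [u1A1 u2A1 ne hl1]]] := two_labels K c1D r1 ltB2.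
have [w1 [w2 [w1A1 w2A1 new hl2]]] := two_labels K c2D r2 ltB2.
have [z1 [z2 [z1A1 z2A1 nez hl3]]] := two_labels K c3D r3 ltB2.
have := once_pair_bound t u1A1 u2A1 ne w1A1 w2A1 new D3 ltB.
have := once_pair_bound t' u1A1 u2A1 ne z1A1 z2A1 nez D3 ltB.
have [_ _] := four_blocks t u1A1 u2A1 ne ltB.
have := once_sub_blocks hl1; have := once_sub_blocks hl2; have := once_sub_blocks hl3.
have := blockA_le K c1 (la c1 u1); have := blockA_le K c1 (la c1 u2).
move=> /=; card_lia.
Qed.

Lemma once_cross c c' u v : c \in D -> c' \in D -> u \in A1 c -> v \in B1 c' ->
  col u v != None -> la c u = lb c v \/ la c' u = lb c' v.
Proof.
move=> cD c'D uc vc'; have [uA _ hu] := once_cover uc; have [vB _ hv] := once_cover vc'.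
case E : (col u v) => [d|] // _; have dD := cfg_col K uA vB E.
have := cfg_lab K uA vB E; case/orP: (cfg_cov K uA vB E).
  by move/(hu _ dD) => ->; left.
by move/(hv _ dD) => ->; right.
Qed.

(* An edge between [once A D X c] and [once B D Y c'] has colour [c] or [c'],   *)
(* so the four edges between representatives of two components of each colour   *)
(* alternate.                                                                   *)
Lemma pairing c c' u1 u2 v1 v2 : c \in D -> c' \in D ->
  s + 2 * h < #|A1 c| -> (forall u, u \in A1 c -> (la c u == la c u1) || (la c u == la c u2)) ->
  v1 \in B1 c' -> v2 \in B1 c' -> lb c' v1 != lb c' v2 -> la c u1 != la c u2 ->
  #|Xb c (lb c v1)| + #|Xb c (lb c v2)| = #|Xb c (la c u1)| + #|Xb c (la c u2)|.
Proof.
move=> cD c'D rich hl v1B1 v2B1 nev neu.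
have [v1B _ _] := once_cover v1B1; have [v2B _ _] := once_cover v2B1.
(* Each of the two components holds more than [2 * h] vertices of [A1 c], the other one holding at
   most [s]; so [v1] and [v2] have a common neighbour in each. *)
have big l l' : (forall u, u \in A1 c -> (la c u == l') || (la c u == l)) ->
   2 * h < #|[set u in A1 c | la c u == l]|.
  move=> hl'; have : #|A1 c| <= #|Xb c l'| + #|[set u in A1 c | la c u == l]|.
    rewrite -cardsUI (leq_trans _ (leq_addr _ _))// subset_leq_card//.
    apply/subsetP => u uA1; have [uA uX _] := once_cover uA1.
    apply/setUP; case/orP: (hl' u uA1) => e; [left|right]; first by rewrite inE uA uX.
    by rewrite inE uA1.
  have := blockA_le K c l'; move: rich; card_lia.
have b2 : 2 * h < #|[set u in A1 c | la c u == la c u2]|.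
  exact: big hl.
have b1 : 2 * h < #|[set u in A1 c | la c u == la c u1]|.
  by apply: (big _ (la c u2)) => u /hl; rewrite orbC.
have sA l : [set u in A1 c | la c u == l] \subset A.
  by apply/subsetP => u /setIdP[/once_cover[]].
have [w1 [/setIdP[w1A1 /eqP l1] e11 e12]] := common_nbr K (sA _) v1B v2B b1.
have [w2 [/setIdP[w2A1 /eqP l2] e21 e22]] := common_nbr K (sA _) v1B v2B b2.
have := once_cross cD c'D w1A1 v1B1 e11; have := once_cross cD c'D w1A1 v2B1 e12.
have := once_cross cD c'D w2A1 v1B1 e21; have := once_cross cD c'D w2A1 v2B1 e22.
rewrite l1 l2; move/eqP: neu => neu; move/eqP: nev => nev.
(* Of the sixteen cases only the two alternating ones are consistent with distinct labels. *)
case=> e22'; case=> e21'; case=> e12'; case=> e11'; try by exfalso; congruence.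

  by rewrite -e22' -e11' addnC.
by rewrite -e21' -e12' addnC.
Qed.

Lemma once_le_double c : c \in D -> 3 * h + 3 * (#|D|.-1 * s) < 2 * #|B| -> #|A1 c| <= 2 * s.
Proof.
move=> cD ltB; case: (leqP #|A1 c| s) => [|rich]; first by lia.
have [u1 [u2 [_ _ _ /once_sub_blocks]]] := two_labels K cD rich ltB.
have := blockA_le K c (la c u1); have := blockA_le K c (la c u2); card_lia.
Qed.

Lemma three_perm12 c1 c2 c3 : three c1 c2 c3 -> three c2 c1 c3.
Proof.
case=> ? ? ? un sD; split=> //.
  by rewrite -(perm_uniq (s1 := [:: c1; c2; c3]))// (perm_cat2r [:: c3] [:: c1; c2] [:: c2;
    c1]) (perm_catC [:: c1] [:: c2]).
by apply: subset_trans sD _; apply/subsetP => c; rewrite !inE orbCA.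
Qed.

Lemma three_rot c1 c2 c3 : three c1 c2 c3 -> three c2 c3 c1.
Proof.
case=> ? ? ? un sD; split=> //; first by rewrite -(rot_uniq 1) in un.
by apply: subset_trans sD _; apply/subsetP => c; rewrite !inE orbC orbA.
Qed.

End Rich.

Lemma three_of_card (C : finType) (D : {set C}) : #|D| = 3 -> exists c1 c2 c3, three D c1 c2 c3.
Proof.
rewrite cardE; case E : (enum D) => [|c1 [|c2 [|c3 []]]] //= _.
exists c1, c2, c3; split; try by rewrite -mem_enum E !inE eqxx ?orbT.
  by rewrite -E enum_uniq.
by apply/subsetP => c; rewrite -mem_enum E.
Qed.

Section Three.
Variables (U V C L : finType) (col : U -> V -> option C) (la : C -> U -> L)
    (lb : C -> V -> L) (X : C -> {set U}) (Y : C -> {set V}) (s h : nat)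
    (A : {set U}) (B : {set V}) (D : {set C}).
Hypothesis K : cfg col la lb X Y s h A B D.
Hypothesis D3 : #|D| = 3.
Hypothesis ltA : 3 * s + 2 * h < #|A|.
Hypothesis ltB : 3 * s + 2 * h < #|B|.

Local Notation Xb := (block A la X).
Local Notation Yb := (block B lb Y).
Local Notation A1 := (once A D X).
Local Notation B1 := (once B D Y).

(** Read from the right, [four_blocks] bounds [#|A|] by the left blocks at [v1], [v2]. By [pairing]
    these add up to the blocks at [u1], [u2] in colour [c1] and at [w1], [w2] in colour [c2]. Up to
    [s] for each pair, they are bounded by the blocks at the opposite representatives, to which
    [four_blocks] applies twice more. *)
Lemma richAAB c1 c2 c3 : three D c1 c2 c3 ->
  s + 2 * h < #|A1 c1| -> s + 2 * h < #|A1 c2| -> s + 2 * h < #|B1 c3| ->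
  #|A| + 2 * #|B| <= 10 * s + 6 * h.
Proof.
move=> t r1 r2 r3; have [c1D c2D c3D _ _] := t; have K' := cfg_swap K.
have ltB2 : 3 * h + 3 * (#|D|.-1 * s) < 2 * #|B| by rewrite D3; move: ltB; card_lia.
have ltA2 : 3 * h + 3 * (#|D|.-1 * s) < 2 * #|A| by rewrite D3; move: ltA; card_lia.
have r1' := leq_ltn_trans (leq_addr _ _) r1; have r2' := leq_ltn_trans (leq_addr _ _) r2.
have r3' := leq_ltn_trans (leq_addr _ _) r3.
have [u1 [u2 [u1A1 u2A1 neu hu]]] := two_labels K c1D r1' ltB2.
have [w1 [w2 [w1A1 w2A1 new hw]]] := two_labels K c2D r2' ltB2.
have [v1 [v2 [v1B1 v2B1 nev hv]]] := two_labels K' c3D r3' ltA2.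
have t3 : three D c3 c1 c2 by do 2 apply: three_rot.
have [_ + _] := four_blocks K' t3 v1B1 v2B1 nev ltA.
have := pairing K c1D c3D r1 hu v1B1 v2B1 nev neu.
have := pairing K c2D c3D r2 hw v1B1 v2B1 nev new.
have := once_pair_bound K t u1A1 u2A1 neu w1A1 w2A1 new D3 ltB.
have [_ _] := four_blocks K t u1A1 u2A1 neu ltB.
have := once_pair_bound K (three_perm12 t) w1A1 w2A1 new u1A1 u2A1 neu D3 ltB.
have [_ _] := four_blocks K (three_perm12 t) w1A1 w2A1 new ltB.
move=> /=; card_lia.
Qed.

Lemma richAA c1 c2 c3 d : three D c1 c2 c3 ->
  100 * h < d -> 3 * s + d <= #|A| -> 3 * s + d <= #|B| -> 7 * s + d <= #|A| + #|B| ->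
  5 * s + 3 * d <= 4 * h + (#|A1 c1| + #|B1 c1|) + (#|A1 c2| + #|B1 c2|) + (#|A1 c3| + #|B1 c3|) ->
  s + 2 * h < #|A1 c1| /\ #|B1 c1| <= 2 * h -> s + 2 * h < #|A1 c2| /\ #|B1 c2| <= 2 * h ->
  s + 2 * h < #|A1 c3| /\ #|B1 c3| <= 2 * h \/ s + 2 * h < #|B1 c3| /\ #|A1 c3| <= 2 * h ->
  False.
Proof.
move=> t hd leA leB leAB sum [r1 n1] [r2 n2] [[r3 n3]|[r3 n3]]; last first.
  have := richAAB t r1 r2 r3; move: hd leB leAB; card_lia.
have r1' := leq_ltn_trans (leq_addr _ _) r1; have r2' := leq_ltn_trans (leq_addr _ _) r2.
have r3' := leq_ltn_trans (leq_addr _ _) r3.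
have := richAAA K t D3 ltB r1' r2' r3'.
move: n1 n2 n3 sum hd leB; card_lia.
Qed.

End Three.

(** * Arithmetic of the count and induction on the number of colours *)

Lemma once_count_three (S s d h a b : nat) :
  100*h<d -> 0 < s -> 3 * s + d <= a -> 3 * s + d <= b -> 7 * s + d <= a + b ->
  a * b + 2 * s * (a + b) <= h * a + s * (3 * (a+b)) + s * S -> 5 * s + 3 * d <= 4 * h + S.
Proof.
move=> hd s0 ha hb hab H.
have [p ep] : exists p, p + h = 2 * s + d by exists (2*s+d-h); lia.
have [a' ea] : exists a', a = a' + p + s by exists (a - p - s); lia.
have [b' eb] : exists b', b = b' + p + s + h by exists (b - p - s - h); lia.
have h3 : 3 * s <= p + a' + b' by lia.
have h4 : 3 * s * p <= p * (p + a' + b') by rewrite mulnC leq_mul2l h3 orbT.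
have e : a * b + 2 * s * (a + b) + s * s + s * h + 0 = h * a + s * (3 * (a + b)) + a' * b' + p * (p + a' + b').
  by subst a b; nia.
have h5 : 3 * s * p <= s * S + s * s + s * h by lia.
have : s * (3 * p) <= s * (S + s + h) by lia.
rewrite leq_pmul2l//; lia.
Qed.

(** With [k = j + 2] the hypothesis bounds the product of [a - j * s] and [b - j * s - h], whose
    factors are at least [p + h] and [p]. If [S] were at most [k * (s + 4 * h)], the terms in
    [s ^ 2] would require [(j + 1) ^ 2 <= j ^ 2 + j + 2], which fails for [j >= 2]. *)
Lemma once_count_many (k S s d h a b : nat) : 3 < k -> 100 * h < d -> 0 < s ->
  (2 * k - 3) * s + d <= a -> (2 * k - 3) * s + d <= b ->
  a * b + 2 * s * (a + b) <= h * a + s * (k * (a + b)) + s * S -> k * (s + 4 * h) < S.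
Proof.
move=> k3 hd s0 ha hb H; rewrite ltnNge; apply/negP => leS.
have [j ej] : exists j, k = j.+2 by exists (k - 2); lia.
have [p ep] : exists p, p + h = j.+1 * s + d by exists (j.+1 * s + d - h); lia.
have [a' ea] : exists a', a = a' + (p + h) + j * s by exists (a - (p + h) - j * s); subst k; nia.
have [b' eb] : exists b', b = b' + p + j * s + h by exists (b - p - j * s - h); subst k; nia.
have H1 : a * b + 2 * s * (a + b) <= h * a + s * (k * (a + b)) + s * (k * (s + 4 * h)).
  by apply: leq_trans H _; rewrite leq_add2l leq_mul2l leS orbT.
have e : a * b + 2 * s * (a + b) + j * s * (j * s) + j * s * h
   = h * a + s * (k * (a + b)) + (a' + (p + h)) * (b' + p).
  by subst a b k; nia.
have H2 : (p + h) * p <= s * (k * (s + 4 * h)) + j * s * (j * s) + j * s * h.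
  have : (p + h) * p <= (a' + (p + h)) * (b' + p) by rewrite leq_mul ?leq_addl.
  by lia.
have [d' ed] : exists d', d = d' + 100 * h + 1 by exists (d - 100 * h - 1); lia.
have p1 : p = j.+1 * s + d' + 99 * h + 1 by lia.
have j2 : exists i, j = i.+2 by exists (j - 2); subst k; lia.
case: j2 => i ei; subst k j; rewrite ep ed p1 in H2.
clear -H2 s0; nia.
Qed.

(** The three colours together have about [5 * s] vertices covered once, and each at most about
    [2 * s]. Hence each has more than [s], essentially on one side. Two of them agree in the side,
    and rotating the colours or exchanging the sides leads to [richAA]. *)
Lemma cfg_three_false (U V C L : finType) (col : U -> V -> option C) (la : C -> U -> L)
    (lb : C -> V -> L) (X : C -> {set U}) (Y : C -> {set V}) (s h d : nat)
    (A : {set U}) (B : {set V}) (D : {set C}) :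
  cfg col la lb X Y s h A B D -> #|D| = 3 -> 100 * h < d -> 0 < s ->
  3 * s + d <= #|A| -> 3 * s + d <= #|B| -> 7 * s + d <= #|A| + #|B| -> False.
Proof.
move=> /cfg_balance[X' [Y' [K bal]]] D3 hd s0 leA leB leAB.
have K' := cfg_swap K.
have ltA : 3 * s + 2 * h < #|A| by move: leA hd; card_lia.
have ltB : 3 * s + 2 * h < #|B| by move: leB hd; card_lia.
have ltB2 : 3 * h + 3 * (#|D|.-1 * s) < 2 * #|B| by rewrite D3; move: ltB; card_lia.
have ltA2 : 3 * h + 3 * (#|D|.-1 * s) < 2 * #|A| by rewrite D3; move: ltA; card_lia.
have [c1 [c2 [c3 t]]] := three_of_card D3.
have [c1D c2D c3D un sD] := t.
pose f c := #|once A D X' c| + #|once B D Y' c|.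
have sum : \sum_(c in D) f c = f c1 + f c2 + f c3.
  rewrite (eq_bigl (mem [:: c1; c2; c3])) => [|c]; last first.
    apply/idP/idP; first by move/(subsetP sD).
    by rewrite !inE => /or3P[] /eqP ->.
  by rewrite -big_uniq //= !big_cons big_nil addn0 addnA.
have cnt : 5 * s + 3 * d <= 4 * h + f c1 + f c2 + f c3.
  have := count_once K bal; rewrite D3 -/(f _) sum.
  have -> : (h + 3 * s < #|B|) by move: ltB; card_lia.
  have -> : (h + 3 * s < #|A|) by move: ltA; card_lia.
  by move=> /(_ isT isT) /(once_count_three hd s0 leA leB leAB); rewrite !addnA.
have dich c : c \in D -> s + 4 * h < f c ->
    s + 2 * h < #|once A D X' c| /\ #|once B D Y' c| <= 2 * h \/
    s + 2 * h < #|once B D Y' c| /\ #|once A D X' c| <= 2 * h.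
  exact: (once_dichotomy K).
have ub c : c \in D -> f c <= 2 * s + 4 * h.
  move=> cD; case: (leqP (f c) (s + 4 * h)) => [|/(dich _ cD)]; first by card_lia.
  have := once_le_double K cD ltB2; have := once_le_double K' cD ltA2; rewrite /f.
  by move=> + + [[_]|[_]]; card_lia.
have d1 : s + 4 * h < f c1 by move: cnt hd (ub _ c2D) (ub _ c3D); clear; lia.
have d2 : s + 4 * h < f c2 by move: cnt hd (ub _ c1D) (ub _ c3D); clear; lia.
have d3 : s + 4 * h < f c3 by move: cnt hd (ub _ c1D) (ub _ c2D); clear; lia.
have leBA : 7 * s + d <= #|B| + #|A| by rewrite (addnC #|B|).
have ltf c c' c'' : 5 * s + 3 * d <= 4 * h + f c + f c' + f c'' ->
    5 * s + 3 * d <= 4 * h + (#|once B D Y' c| + #|once A D X' c|) +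
      (#|once B D Y' c'| + #|once A D X' c'|) + (#|once B D Y' c''| + #|once A D X' c''|).
  by rewrite /f; card_lia.
have t2 := three_rot t; have t3 := three_rot t2.
have cnt2 : 5 * s + 3 * d <= 4 * h + f c2 + f c3 + f c1 by move: cnt; clear; lia.
have cnt3 : 5 * s + 3 * d <= 4 * h + f c3 + f c1 + f c2 by move: cnt; clear; lia.
have coreA e1 e2 e3 te se := @richAA _ _ _ _ _ _ _ _ _ _ _ _ _ _ K D3 ltA ltB e1 e2 e3 d te hd leA leB leAB se.
have coreB e1 e2 e3 te se := @richAA _ _ _ _ _ _ _ _ _ _ _ _ _ _ K' D3 ltB ltA e1 e2 e3 d te hd leB leA leBA (ltf _ _ _ se).
have q1 := dich _ c1D d1; have q2 := dich _ c2D d2; have q3 := dich _ c3D d3.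
have or_sym P Q : P \/ Q -> Q \/ P by tauto.
case: (q1) => r1; case: (q2) => r2.
- exact: coreA t cnt r1 r2 q3.
- case: (q3) => r3; first exact: coreA t3 cnt3 r3 r1 q2.
  by apply: (coreB _ _ _ t2 cnt2 r2 r3); apply: or_sym.
- case: (q3) => r3; first exact: coreA t2 cnt2 r2 r3 q1.
  by apply: (coreB _ _ _ t3 cnt3 r3 r1); apply: or_sym.
- by apply: (coreB _ _ _ t cnt r1 r2); apply: or_sym.
Qed.

Lemma cfg_false (U V C L : finType) (col : U -> V -> option C) (la : C -> U -> L)
    (lb : C -> V -> L) (s h d k : nat) (A : {set U}) (B : {set V}) (D : {set C}) X Y :
  cfg col la lb X Y s h A B D -> #|D| = k -> 3 < k -> 100 * h < d -> 0 < s ->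
  (2 * k - 3) * s + d <= #|A| -> (2 * k - 3) * s + d <= #|B| -> False.
Proof.
elim: k => // k IH in A B D X Y *.
move=> /cfg_balance[X' [Y' [K bal]]] Dk k3 hd s0 leA leB.
have K' := cfg_swap K.
have ltA : h + #|D| * s < #|A| by rewrite Dk; move: leA hd s0 k3; clear; nia.
have ltB : h + #|D| * s < #|B| by rewrite Dk; move: leB hd s0 k3; clear; nia.
have ltB2 : 3 * h + 3 * (#|D|.-1 * s) < 2 * #|B| by rewrite Dk /=; move: leB hd s0 k3; clear; nia.
have ltA2 : 3 * h + 3 * (#|D|.-1 * s) < 2 * #|A| by rewrite Dk /=; move: leA hd s0 k3; clear; nia.
have := count_once K bal ltB ltA; rewrite Dk => /(once_count_many k3 hd s0 leA leB) big.
have [c cD bigc] : exists2 c, c \in D & s + 4 * h < #|once A D X' c| + #|once B D Y' c|.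
  pose P c := (c \in D) && (s + 4 * h < #|once A D X' c| + #|once B D Y' c|).
  case: (pickP P) => [c /andP[]|none]; first by exists c.
  move: big; rewrite ltnNge -{1}Dk -sum_nat_const leq_sum// => c cD.
  by have := none c; rewrite /P cD /= ltnNge => /negbFE.
have Dc : #|D :\ c| = k by move: Dk; rewrite (cardsD1 c) cD /= add1n => -[].
have k2 : k = 3 \/ 3 < k by lia.
(* Up to slack the new sides are at least [(2k - 1)s - x] and [(2k - 4)s + x]. As [s <= x <= 2 * s],
   both are at least [(2k - 3)s], and their sum is at least [7 * s] when [k = 3]. *)
have num a b a' b' x : (2 * k.+1 - 3) * s + d <= a -> (2 * k.+1 - 3) * s + d <= b ->
    s <= x <= 2 * s -> a <= a' + x -> 2 * b + x <= b' + 2 * h + 2 * (k * s) + 2 * s ->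
    (k = 3 -> [/\ 3 * s + d <= a', 3 * s + d <= b' & 7 * s + d <= a' + b']) /\
    (3 < k -> (2 * k - 3) * s + d <= a' /\ (2 * k - 3) * s + d <= b').
  clear -hd => ha hb /andP[lex lex2] ha' hb'; split=> [k3'|k3'].
    by subst k; split; lia.
  have [i ei] : exists i, k = i.+4 by exists (k - 4); lia.
  have e1 : 2 * k.+1 - 3 = 2 * i + 7 by lia.
  have e2 : 2 * k - 3 = 2 * i + 5 by lia.
  by rewrite e1 in ha hb; rewrite e2; subst k; split; nia.
have fin A' B' Z Z' : cfg col la lb Z Z' s h A' B' (D :\ c) ->
    (k = 3 -> [/\ 3 * s + d <= #|A'|, 3 * s + d <= #|B'| & 7 * s + d <= #|A'| + #|B'|]) /\
    (3 < k -> (2 * k - 3) * s + d <= #|A'| /\ (2 * k - 3) * s + d <= #|B'|) -> False.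
  move=> K1 [n3 n4]; case: k2 => [k3'|k3'].
    have [leA' leB' leAB'] := n3 k3'; rewrite k3' in Dc.
    exact: cfg_three_false K1 Dc hd s0 leA' leB' leAB'.
  by have [leA' leB'] := n4 k3'; apply: IH K1 Dc k3' hd s0 leA' leB'.
have gt_s x : s + 2 * h < x -> s < x by apply/leq_ltn_trans/leq_addr.
case: (once_dichotomy K cD bigc) => -[/gt_s rich _].
  have [A' [B' [x [K1 hx hA hB]]]] := delete_colour K cD rich ltB2.
  by rewrite Dk in hB; apply: fin K1 (num _ _ _ _ _ leA leB hx hA hB).
have [B' [A' [x [K1 hx hB hA]]]] := delete_colour K' cD rich ltA2.
rewrite Dk in hA; apply: fin (cfg_swap K1) _.
have [n3 n4] := num _ _ _ _ _ leB leA hx hB hA.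
by split=> [/n3[? ? ?]|/n4[]]; split; rewrite // (addnC #|A'|).
Qed.

(** * Cycles of prescribed length *)

Section LongPath.
Variables (T : finType) (e : rel T) (side : T -> bool).
Hypothesis e_sym : symmetric e.
Hypothesis e_side : forall x y, e x y -> side y = ~~ side x.

Definition no_bihole b (A B : {set T}) := forall S S' : {set T},
  S \subset A -> S' \subset B -> b <= #|S| -> b <= #|S'| ->
  exists x y, [/\ x \in S, y \in S' & e x y].

Lemma no_bihole_sub b (A A' B B' : {set T}) : A' \subset A -> B' \subset B ->
  no_bihole b A B -> no_bihole b A' B'.
Proof.
by move=> sA sB H S S' sS sS'; apply: H; [apply: subset_trans sA|apply: subset_trans sB].
Qed.

Lemma no_bihole_sym b A B : no_bihole b A B -> no_bihole b B A.
Proof.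
move=> H S S' sS sS' cS cS'; have [x [y [xS yS xy]]] := H _ _ sS' sS cS' cS.
by exists y, x; rewrite e_sym.
Qed.

Lemma count_side z x p : path e x p ->
  2 * count (fun y => side y == z) (x :: p) <= size (x :: p) + (side x == z).
Proof.
elim: p x => [|y p IH] x /=; first by case: (side x == z).
case/andP=> /e_side xy /IH /=; rewrite xy.
have -> : (~~ side x == z) = ~~ (side x == z) by clear; case: z; case: (side x).
by case: (side x == z) => /=; lia.
Qed.

Lemma side_nth x0 p i : sorted e p -> i < size p -> side (nth x0 p i) = odd i (+) side (head x0 p).
Proof.
move=> sp; elim: i => [|i IH] lt; first by case: p {sp lt}.
have := sortedP x0 sp; move/(_ _ lt)/e_side ->.
by rewrite IH /=; [case: odd; case: side|apply: ltnW].
Qed.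

(* Depth-first search: [p] is the current path, [D] the set of finished         *)
(* vertices, which has no neighbour among the unvisited ones.                   *)
Lemma dfs b (X Y : {set T}) n p (D : {set T}) : no_bihole b X Y ->
  let W := X :|: Y in
  2 * #|W :\: D :\: [set x in p]| + size p < n ->
  sorted e p -> uniq p -> {subset p <= W} -> D \subset W -> {in p, forall x, x \notin D} ->
  (forall d r, d \in D -> r \in W :\: D :\: [set x in p] -> ~~ e d r) ->
  #|D :&: X| <= b -> #|D :&: Y| <= b ->
  exists p', [/\ sorted e p', uniq p', {subset p' <= W} &
    #|X :\: [set x in p']| <= 2 * b \/ #|Y :\: [set x in p']| <= 2 * b].
Proof.
(* Unvisited vertices count twice in the measure: visiting one lengthens [p], finishing one shortens
   it, and both moves decrease the measure. *)
move=> nb W; elim: n p D => // n IH p D; rewrite ltnS => le sp up pW DW pD noE leX leY.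
pose R := W :\: D :\: [set x in p].
have split (Z : {set T}) : Z \subset W -> #|Z :\: [set x in p]| <= #|D :&: Z| + #|R :&: Z|.
  move=> ZW; have := leq_card_setU (D :&: Z) (R :&: Z).
  case=> le' _; apply: leq_trans le'; apply/subset_leq_card/subsetP => x.
  rewrite /R !inE => /andP[-> xZ]; rewrite xZ !andbT /=.
  by have := subsetP ZW x xZ; rewrite !inE => ->; rewrite andbT orbN.
(* Once [D] has [b] vertices on one side, fewer than [b] unvisited ones remain on the other, and
   with at most [b] finished ones there the search may stop. *)
have [bX|bX] := leqP b #|D :&: X|.
  have [bR|bR] := leqP b #|R :&: Y|.
    have [x [y [/setIP[xD _] /setIP[yR _] xy]]] := nb _ _ (subsetIr _ _) (subsetIr _ _) bX bR.
    by have := noE x y xD yR; rewrite xy.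
  exists p; split=> //; right; move: (split Y (subsetUr _ _)) leY bR; card_lia.
have [bY|bY] := leqP b #|D :&: Y|.
  have [bR|bR] := leqP b #|R :&: X|.
    have [x [y [/setIP[xR _] /setIP[yD _] xy]]] := nb _ _ (subsetIr _ _) (subsetIr _ _) bR bY.
    by have := noE y x yD xR; rewrite e_sym xy.
  exists p; split=> //; left; move: (split X (subsetUl _ _)) leX bR; card_lia.
have grow r (q := r :: p) : r \in R -> sorted e q -> exists p', [/\
  sorted e p', uniq p', {subset p' <= W} &
    #|X :\: [set x in p']| <= 2 * b \/ #|Y :\: [set x in p']| <= 2 * b].
  move=> rR sq; have /setDP[/setDP[rW rD] rp] := rR; rewrite inE in rp.
  have eR : R = r |: (W :\: D :\: [set x in q]).
    apply/setP => x; rewrite /R !inE; case: (eqVneq x r) => [->|//].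
    by rewrite (negbTE rp) rD /=; move: rW; rewrite inE.
  apply: (IH q D) => //=.
  - by move: le; rewrite -/R eR cardsU1 !inE eqxx /=; card_lia.
  - by rewrite rp.
  - by move=> x; rewrite inE => /orP[/eqP->|/pW].
  - by move=> x; rewrite inE => /orP[/eqP->|/pD].
  - by move=> d x dD xR; apply: noE => //; rewrite -/R eR in_setU1 xR orbT.
case: (pickP (fun r => (r \in R) &&
  (if p is x :: _ then e r x else true))) => [r /andP[rR er]|none].
  by apply: (grow r rR); case: p er sp {le up pW pD noE split grow R rR} => //= x p -> ->.
case: p => [|x p] in R le sp up pW pD noE split grow none *.
  exists [::]; split=> //; left; have := split X (subsetUl _ _).
  have -> : R :&: X = set0.
    by apply/setP=> r; rewrite in_setI in_set0; have := none r; rewrite andbT => ->.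
  by rewrite cards0; move: leX; card_lia.
have xW : x \in W by apply: pW; rewrite mem_head.
have xD : x \notin D by apply: pD; rewrite mem_head.
have [xp up'] := andP up.
have eR : W :\: (x |: D) :\: [set y in p] = R.
  by apply/setP => y; rewrite /R !inE !negb_or; case: (y == x); case: (y \in p).
have cD (Z : {set T}) : #|(x |: D) :&: Z| <= #|D :&: Z|.+1.
  by rewrite setIUl (leq_trans (leq_card_setU _ _).1)// -add1n leq_add2r -(cards1 x) subset_leq_card ?subsetIl.
(* The head [x] has no unvisited neighbour left, so it is finished and the search backtracks. *)
apply: (IH p (x |: D)) => //.
- by rewrite eR; move: le; rewrite -/R /=; card_lia.
- exact: path_sorted sp.
- by move=> y yp; apply: pW; rewrite inE yp orbT.
- by rewrite subUset sub1set xW.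
- move=> y yp; rewrite !inE negb_or pD ?inE ?yp ?orbT// andbT.
  by apply: contraNneq xp => <-.
- move=> d r; rewrite in_setU1 eR => /orP[/eqP -> rR|dD rR]; last exact: noE.
  by have := none r; rewrite rR /= e_sym => ->.
- exact: leq_trans (cD X) bX.
- exact: leq_trans (cD Y) bY.
Qed.

(** The path from [dfs] misses at most [2 * b] vertices of one side; since it alternates, its order
    is at least twice the number it meets there, minus one. *)
Lemma long_path b (X Y : {set T}) :
  {in X, forall x, side x} -> {in Y, forall y, ~~ side y} -> no_bihole b X Y ->
  exists p, [/\ sorted e p, uniq p, {subset p <= X :|: Y} &
    2 * minn #|X| #|Y| <= (size p).+1 + 4 * b].
Proof.
move=> sX sY nb.
have card_count (Z : {set T}) (p : seq T) z : (forall x, x \in Z -> side x = z) ->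
    sorted e p -> #|Z :\: [set x in p]| <= 2 * b -> 2 * #|Z| <= (size p).+1 + 4 * b.
  move=> hz sp leZ; have : #|Z :&: [set x in p]| <= count (fun y => side y == z) p.
    rewrite -size_filter cardE uniq_leq_size ?enum_uniq// => x.
    by rewrite mem_enum !inE mem_filter => /andP[/hz -> ->]; rewrite eqxx.
  have := cardsID [set x in p] Z.
  case: p sp leZ => [|x p] sp leZ; first by move: leZ => /=; card_lia.
  have := count_side z sp; case: (side x == z); rewrite [size (x :: p)]/=; move: leZ; card_lia.
have [||||||||p [sp up pW [le|le]]] := @dfs b X Y _ [::] set0 nb (ltnSn _) => //.
- exact: sub0set.
- by move=> d r; rewrite inE.
- by rewrite set0I cards0.
- by rewrite set0I cards0.
- exists p; split=> //; by rewrite (leq_trans _ (card_count X p true sX sp le))// leq_mul2l geq_minl orbT.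
- exists p; split=> //; have := card_count Y p false (fun y yY => negbTE (sY y yY)) sp le.
  by apply: leq_trans; rewrite leq_mul2l geq_minr orbT.
Qed.

(* On a long path all but few positions can be entered from [S] and all but few *)
(* can be left to [S'], so two positions at the prescribed distance work.       *)
Lemma exact_path b h (A B S S' : {set T}) :
  {in A, forall x, side x} -> {in B, forall y, ~~ side y} -> no_bihole b A B ->
  S \subset B -> S' \subset A -> #|S| = b -> #|S'| = b -> 0 < h -> forall F : {set T},
  h + 4 * b + 2 + #|F| <= minn #|A :\: S'| #|B :\: S| ->
  exists s q t, [/\ s \in S, t \in S', path e s (rcons q t), uniq q &
    size q = 2 * h /\ forall x, x \in q -> (x \in A :\: S' :|: B :\: S) && (x \notin F)].
Proof.
move=> sA sB nb SB S'A cS cS' h0 F leF.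
have b0 : 0 < b.
  case: (posnP b) => // b0; move: nb; rewrite b0 => /(_ set0 set0 (sub0set _) (sub0set _)).
  by rewrite cards0 => /(_ isT isT) [x [y []]]; rewrite inE.
pose X := A :\: S' :\: F; pose Y := B :\: S :\: F.
have XA : X \subset A by rewrite /X setDDl subsetDl.
have YB : Y \subset B by rewrite /Y setDDl subsetDl.
have [|||p [sp up pW le]] := @long_path b X Y.
- by move=> x /(subsetP XA)/sA.
- by move=> x /(subsetP YB)/sB.
- exact: no_bihole_sub nb.
have lep : 2 * h + 4 * b + 3 <= size p.
  have cF (Z : {set T}) : #|Z| <= #|Z :\: F| + #|F|.
    by rewrite -(cardsID F Z) addnC leq_add2l subset_leq_card ?subsetIr.
  have := cF (A :\: S'); have := cF (B :\: S); rewrite -/X -/Y.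
  by move: leF le; clear; lia.
case: p => [|x0 p] in sp up pW lep le *; first by rewrite /= addnC in lep.
(* Dropping at most one vertex puts [A] at the even positions. *)
pose p1 := drop (~~ side x0) (x0 :: p).
have sp1 : sorted e p1 by apply: drop_sorted.
have up1 : uniq p1 by apply: drop_uniq.
have sub1 : {subset p1 <= x0 :: p} by move=> x; apply: mem_drop.
have size1 : 2 * h + 4 * b + 2 <= size p1 by rewrite size_drop; move: lep; case: (side x0);
  clear; lia.
have side1 i : i < size p1 -> side (nth x0 p1 i) = ~~ odd i.
  move=> lt; rewrite side_nth//; have -> : side (head x0 p1) = true; last by rewrite addbT.
  rewrite -nth0 nth_drop addn0 side_nth//; first by rewrite /=; case: (side x0).
  by move: lep; case: (side x0); clear; lia.
have inX i : i < size p1 -> ~~ odd i -> nth x0 p1 i \in X.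
  move=> lt od; have /setUP[//|/(subsetP YB)/sB] := pW _ (sub1 _ (mem_nth x0 lt)).
  by rewrite side1// od.
have inY i : i < size p1 -> odd i -> nth x0 p1 i \in Y.
  move=> lt od; have /setUP[/(subsetP XA)/sA|//] := pW _ (sub1 _ (mem_nth x0 lt)).
  by rewrite side1// od.
(* [2 * b] segments of [2 * h] vertices are tried, from [a i] to [c i]. Fewer than [b] fail at
   either end, as the failing ends would form a hole with [S] or [S']. *)
pose a (i : 'I_(2 * b)) := nth x0 p1 (2 * i).
pose c (i : 'I_(2 * b)) := nth x0 p1 (2 * i + (2 * h).-1).
have lta (i : 'I_(2 * b)) : 2 * i < size p1 by move: (ltn_ord i) size1; clear; lia.
have ltc (i : 'I_(2 * b)) : 2 * i + (2 * h).-1 < size p1 by move: (ltn_ord i) size1 h0; clear; lia.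
have inja : injective a.
  by move=> i j /eqP; rewrite nth_uniq// => /eqP ij; apply: val_inj => /=; move: ij; clear; lia.
have injc : injective c.
  by move=> i j /eqP; rewrite nth_uniq// => /eqP ij; apply: val_inj => /=; move: ij; clear; lia.
have aX i : a i \in X by apply: inX => //; rewrite mul2n odd_double.
have cY i : c i \in Y.
  by apply: inY => //; rewrite oddD mul2n odd_double /=; case: (h) h0 => // h' _;
    rewrite mulnS add2n /= mul2n odd_double.
pose bad1 := [set i | [forall s in S, ~~ e s (a i)]].
pose bad2 := [set i | [forall t in S', ~~ e (c i) t]].
have lt1 : #|bad1| < b.
  rewrite ltnNge; apply/negP => ge.
  have [||||x [y [/imsetP[i]]]] := nb (a @: bad1) S => //.
  - by apply/subsetP => _ /imsetP[i _ ->]; apply: (subsetP XA).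
  - by rewrite card_imset.
  - by rewrite cS.
  rewrite inE => /forall_inP hi -> yS; rewrite e_sym => xy.
  by have := hi y yS; rewrite xy.
have lt2 : #|bad2| < b.
  rewrite ltnNge; apply/negP => ge.
  have [||||x [y [xS /imsetP[i]]]] := nb S' (c @: bad2) => //.
  - by apply/subsetP => _ /imsetP[i _ ->]; apply: (subsetP YB).
  - by rewrite cS'.
  - by rewrite card_imset.
  rewrite inE => /forall_inP hi ->; rewrite e_sym => xy.
  by have := hi x xS; rewrite xy.
have [i] : exists j, j \notin bad1 :|: bad2.
  apply/existsP; rewrite -negb_forall; apply/negP => /forallP all.
  have : #|bad1 :|: bad2| = 2 * b.
    by rewrite -[RHS]card_ord -cardsT; congr #|pred_of_set _|; apply/setP=> i; rewrite all inE.
  move: (leq_card_setU bad1 bad2).1 lt1 lt2; card_lia.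
rewrite in_setU negb_or !inE !negb_forall_in => /andP[/exists_inP[s sS es] /exists_inP[t tS' et]].
rewrite !negbK in es et.
pose q := take (2 * h) (drop (2 * i) p1).
have sq : size q = 2 * h.
  by rewrite size_takel// size_drop; move: (ltc i) h0; clear; lia.
have subq : {subset q <= p1} by move=> x /mem_take /mem_drop.
exists s, q, t; split=> //.
- rewrite rcons_path; have nq j : j < 2 * h -> nth x0 q j = nth x0 p1 (2 * i + j).
    by move=> lt; rewrite nth_take// nth_drop.
  have sq' : sorted e q by apply/take_sorted/drop_sorted.
  have hq : nth x0 q 0 = a i by rewrite nq ?addn0// muln_gt0.
  have tq : nth x0 q (2 * h).-1 = c i by rewrite nq// ltn_predL muln_gt0.
  move: sq hq tq sq'; case: (q) => [|x r]; first by move=> /= sq; move: sq h0; clear; lia.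
  move=> sxr /= hx; rewrite -sxr nth_last /= => ht pr.
  by rewrite hx es -hx pr ht.
- exact/take_uniq/drop_uniq.
split=> // x /subq /sub1 /pW /setUP[] /setDP[xZ ->]; rewrite in_setU xZ ?orbT //.
Qed.

Lemma subset_of_card (Z : {set T}) n : n <= #|Z| -> exists2 S : {set T}, S \subset Z & #|S| = n.
Proof.
move=> le; exists [set x in take n (enum Z)].
  by apply/subsetP => x; rewrite inE => /mem_take; rewrite mem_enum.
by rewrite cardsE (card_uniqP _) ?take_uniq ?enum_uniq// size_takel// -cardE.
Qed.

Definition nbrs u (Z : {set T}) := [set x in Z | e u x].

(** [exact_path] is used with [b] neighbours of [u] as entrances and [b] neighbours of [v] as exits;
    the entrance and exit chosen turn [h] into [h.+1]. *)
Lemma fill b h (A B : {set T}) u v (F : {set T}) :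
  {in A, forall x, side x} -> {in B, forall y, ~~ side y} -> no_bihole b A B ->
  b + #|F| <= #|nbrs u B| -> b + #|F| <= #|nbrs v A| -> 0 < h ->
  h + 5 * b + 2 + #|F| <= minn #|A| #|B| ->
  exists z, [/\ path e u z, e (last u z) v, uniq z, size z = 2 * h.+1 &
    forall x, x \in z -> (x \in A :|: B) && (x \notin F)].
Proof.
move=> sA sB nb du dv h0 le.
have subF (Z : {set T}) : b + #|F| <= #|Z| -> b <= #|Z :\: F|.
  have := cardsID F Z; have := subset_leq_card (subsetIr Z F); card_lia.
have [S SN cS] := subset_of_card (subF _ du); have [S' S'N cS'] := subset_of_card (subF _ dv).
have SB : S \subset B.
  by apply: subset_trans SN _; apply/subsetP => x; rewrite !inE => /andP[_ /andP[]].
have S'A : S' \subset A.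
  by apply: subset_trans S'N _; apply/subsetP => x; rewrite !inE => /andP[_ /andP[]].
have [|s [q [t [sS tS' p uq [sq qP]]]]] := exact_path sA sB nb SB S'A cS cS' h0 (F := F).
  by rewrite !cardsD (setIidPr SB) (setIidPr S'A) cS cS'; move: le; card_lia.
have := subsetP SN _ sS; have := subsetP S'N _ tS'; rewrite !inE.
move=> /andP[tF /andP[tA vt]] /andP[sF /andP[sB' us]].
exists (s :: rcons q t); split.
- by rewrite /= us p.
- by rewrite /= last_rcons e_sym.
- rewrite /= mem_rcons inE rcons_uniq uq negb_or andbT -andbA; apply/and3P; split.
  + by apply: contraTneq (sA _ tA) => <-; apply: sB.
  + by apply/negP => /qP /andP[/setUP[/setDP[sA' _]|/setDP[_ /negP]] _] //; move: (sA _ sA');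
      rewrite (negbTE (sB s sB')).
  + by apply/negP => /qP /andP[/setUP[/setDP[_ /negP]|/setDP[tB _]] _] //; move: (sB _ tB);
      rewrite (sA t tA).
- by rewrite /= size_rcons sq; clear; lia.
move=> x; rewrite inE mem_rcons inE => /or3P[/eqP->|/eqP->|/qP/andP[xAB ->]].
- by rewrite sF !inE sB' orbT.
- by rewrite tF !inE tA.
- by rewrite andbT; move: xAB; rewrite !inE => /orP[]/andP[_ ->]; rewrite ?orbT.
Qed.

(** * Routing a cycle through the clusters *)

Section Clusters.
Variables (I : finType) (cl : I -> {set T}) (red : rel I) (m b g : nat).
Hypothesis card_cl : forall c, #|cl c| = m.
Hypothesis disj_cl : forall c c', c != c' -> [disjoint cl c & cl c'].
Hypothesis red_sym : symmetric red.
Hypothesis red_nb : forall c c', red c c' -> no_bihole b (cl c) (cl c').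

Definition rich c c' := [set u in cl c | g <= #|nbrs u (cl c')|].
Hypothesis red_rich : forall c c', red c c' -> g <= #|rich c c'|.

(** At least [b] vertices outside [F] of the next cluster can be reached from [S], since otherwise
    the others would form a hole with [S]. *)
Lemma walk c p (S S' F : {set T}) : path red c p -> p != [::] ->
  S \subset cl c :\: F -> S' \subset cl (last c p) :\: F -> b <= #|S| -> b <= #|S'| ->
  2 * b + #|F| <= m ->
  exists s w, [/\ s \in S, path e s w, last s w \in S', {in w, forall x, x \notin F} &
    size w = size p].
Proof.
move=> + + + + + cS' leF; elim: p c S => // c1 p IH c S /andP[cc1 cp] _ SF S'F cS.
have subF (Z : {set T}) (d : I) : Z \subset cl d :\: F -> Z \subset cl d.
  by move=> ZF; apply: subset_trans ZF (subsetDl _ _).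
case: p IH cp S'F => [_ _ S'F|c2 p IH cp S'F].
  have [x [y [xS yS' xy]]] := red_nb cc1 (subF _ _ SF) (subF _ _ S'F) cS cS'.
  exists x, [:: y]; split; rewrite //= ?xy// => z; rewrite inE => /eqP ->.
  by have := subsetP S'F _ yS'; rewrite inE => /andP[].
pose S1 := [set y in cl c1 :\: F | [exists x in S, e x y]].
have cS1 : b <= #|S1|.
  rewrite leqNgt; apply/negP => lt.
  have : b <= #|(cl c1 :\: F) :\: S1|.
    rewrite !cardsD card_cl; have := subset_leq_card (subsetIr (cl c1) F).
    have := subset_leq_card (subsetIr (cl c1 :\: F) S1); move: lt leF; card_lia.
  have sub1 : (cl c1 :\: F) :\: S1 \subset cl c1 by rewrite setDDl subsetDl.
  move/(red_nb cc1 (subF _ _ SF) sub1 cS) => [x [y [xS + xy]]].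
  by case/setDP=> yC; rewrite inE yC => /negP; case; apply/exists_inP; exists x.
have S1F : S1 \subset cl c1 :\: F by apply/subsetP => x; rewrite inE => /andP[].
have [s [w [sS1 pw lw wF sw]]] := IH c1 S1 cp isT S1F S'F cS1.
have /setIdP[+ /exists_inP[x xS xs]] := sS1; rewrite inE => /andP[sF _].
exists x, (s :: w); split; rewrite //= ?xs ?sw// => y; rewrite inE => /orP[/eqP ->//|]; exact: wF.
Qed.

(** The sequence of clusters is shortened first, which bounds the order by [#|I|], and the resulting
    walk of vertices is shortened afterwards to a path. *)
Lemma connector c c' (S S' F : {set T}) : connect red c c' -> c != c' ->
  S \subset cl c -> S' \subset cl c' -> b + #|F| <= #|S| -> b + #|F| <= #|S'| ->
  2 * b + #|F| <= m ->
  exists s w, [/\ s \in S, path e s w, last s w \in S', uniq (s :: w) &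
    {in s :: w, forall x, x \notin F} /\ size (s :: w) <= #|I|].
Proof.
move=> /connectP[p0 p0P ->]; case/shortenP: p0P => p pP up _ ne SA S'A cS cS' leF.
have subF (Z : {set T}) : b + #|F| <= #|Z| -> b <= #|Z :\: F|.
  have := cardsID F Z; have := subset_leq_card (subsetIr Z F); card_lia.
have pn : p != [::] by apply: contraNneq ne => ->.
have [s [w [/setDP[sS sF] pw /setDP[lw _] wF sw]]] :=
  walk pP pn (setSD F SA) (setSD F S'A) (subF _ cS) (subF _ cS') leF.
have lep : size p < #|I| by have := card_uniqP up => /= <-; apply: max_card.
move: lw; case/shortenP: pw => w' pw' uw' sub lw'.
exists s, w'; split=> //; split.
  by move=> x; rewrite inE => /orP[/eqP ->//|/sub]; apply: wF.
move: sw lep (uniq_leq_size (proj2 (andP uw')) sub).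
by rewrite /=; clear; lia.
Qed.

Variable sideI : I -> bool.
Hypothesis side_cl : forall c x, x \in cl c -> side x = sideI c.

Definition oriented (P : I * I) := [&& red P.1 P.2, sideI P.1 & ~~ sideI P.2].

(* A cyclic sequence of matching edges P, each with a short path from P.2 to    *)
(* the next edge; [assemble] inserts long paths inside the pairs P.             *)
Fixpoint chain (u : T) (l : seq ((I * I) * seq T)) : Prop :=
  if l is (P, q) :: l' then
    u \in rich P.1 P.2 /\
    (if q is v :: w then [/\ path e v w, v \in rich P.2 P.1 & chain (last v w) l'] else False)
  else True.

Definition links (l : seq ((I * I) * seq T)) := flatten (map snd l).

Lemma rich_sub c c' : rich c c' \subset cl c.
Proof. by apply/subsetP => x; rewrite inE => /andP[]. Qed.

(** The links are built from the last to the first, each avoiding [F] and the later links. The last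
    one returns to the rich vertices of [P0], so the chain closes up when [P0] is also the head of
    [l]. *)
Lemma skeleton c0 P0 l (F : {set T}) : oriented P0 -> connect red c0 P0.1 ->
  all oriented l -> {in l, forall P, connect red c0 P.1} ->
  b + #|F| + size l * #|I| <= g -> 2 * b + #|F| + size l * #|I| <= m ->
  exists lQ, [/\ map fst lQ = l,
    forall u, u \in rich (head P0 l).1 (head P0 l).2 ->
      chain u lQ /\ last u (links lQ) \in rich P0.1 P0.2,
    uniq (links lQ), {in links lQ, forall x, x \notin F} &
    size (links lQ) <= size l * #|I| /\ ~~ odd (size (links lQ))].
Proof.
move=> o0 c0P0; elim: l => [|P l IH]; first by exists [::].
move=> /= /andP[oP ol] cl0 leg lem.
have [||||lQ [fQ ch uQ QF [sQ eQ]]] := IH => //.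
- by move=> P' P'l; apply: cl0; rewrite inE P'l orbT.
- by move: leg; rewrite mulSn; card_lia.
- by move: lem; rewrite mulSn; card_lia.
set P' := head P0 l in ch *.
have oP' : oriented P' by rewrite /P'; case: (l) ol => //= ? ? /andP[].
have cP' : connect red c0 P'.1.
  by rewrite /P'; case: (l) cl0 => //= P1 l1; apply; rewrite !inE eqxx orbT.
pose F' := F :|: [set x in links lQ].
have cF' : #|F'| <= #|F| + size l * #|I|.
  rewrite (leq_trans (leq_card_setU _ _).1)// leq_add2l.
  by rewrite cardsE (leq_trans (card_size _)).
have /and3P[rP s1 s2] := oP; have /and3P[rP' s1' s2'] := oP'.
have csym : connect_sym red by apply: sym_connect_sym.
have [|||||||s [w [sS pw lw uw [wF lew]]]] :=
  @connector P.2 P'.1 (rich P.2 P.1) (rich P'.1 P'.2) F'.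
- apply: connect_trans cP'; apply: connect_trans (_ : connect red P.2 P.1) _.
    by apply: connect1; rewrite red_sym.
  by rewrite csym; apply: cl0; rewrite inE eqxx.
- by apply: contraNneq s2 => ->.
- exact: rich_sub.
- exact: rich_sub.
- apply: leq_trans (red_rich _); last by rewrite red_sym.
  by move: leg cF'; rewrite mulSn; card_lia.
- by apply: leq_trans (red_rich rP'); move: leg cF'; rewrite mulSn; card_lia.
- by move: lem cF'; rewrite mulSn; card_lia.
exists ((P, s :: w) :: lQ); split.
- by rewrite /= fQ.
- move=> u uP; have [ch' l'] := ch _ lw.
  by split=> //; rewrite /links /= last_cat.
- rewrite /links [flatten _]/= -cat_cons cat_uniq uw uQ andbT; apply/hasPn => x xQ;
    apply/negP => /wF.
  by rewrite !inE xQ orbT.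
- move=> x; rewrite /links [flatten _]/= -cat_cons mem_cat => /orP[/wF|/QF//].
  by rewrite !inE negb_or => /andP[].
rewrite /links /= size_cat -/(links lQ) mulSn; split.
  by move: lew sQ => /=; card_lia.
(* A link leads from a right cluster to a left one, so its order is even. *)
rewrite /= negbK oddD (negbTE eQ) addbF.
have := @side_nth s (s :: w) (size w) pw (ltnSn _); rewrite nth_last /=.
rewrite (side_cl (subsetP (rich_sub _ _) _ lw)) (side_cl (subsetP (rich_sub _ _) _ sS)).
by rewrite s1' (negbTE s2) addbF => <-.
Qed.

(** [2 * w] vertices are to be inserted in all, twice a number between 2 and [H] in each matched
    pair; hence the two bounds on [w]. *)
Lemma assemble H (F : {set T}) lQ u w : b + #|F| <= g -> H + 5 * b + 1 + #|F| <= m ->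
  chain u lQ -> {in links lQ, forall x, x \in F} -> uniq (links lQ) ->
  all oriented (map fst lQ) -> uniq (flatten [seq [:: P.1; P.2] | P <- map fst lQ]) ->
  2 * size lQ <= w <= size lQ * H ->
  exists z, [/\ path e u z, last u z = last u (links lQ), uniq z,
    size z = 2 * w + size (links lQ) &
    forall x, x \in z -> x \in links lQ \/ x \notin F /\
      exists c, c \in flatten [seq [:: P.1; P.2] | P <- map fst lQ] /\ x \in cl c].
Proof.
move=> leg lem; elim: lQ u w => [|[P q] lQ IH] u w.
  by move=> _ _ _ _ _ /andP[_]; rewrite mul0n leqn0 => /eqP ->; exists [::].
case: q => [|v q] /= [uP] // [pq vP ch] QF uQ /andP[oP ol] uP2 /andP[lew Hew].

have /and3P[rP s1 s2] := oP.
(* The first pair takes as much as it can while leaving 2 for each later one. [k >= 2] is needed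
   because [fill] is called with [k.-1], which must be positive. *)
pose k := minn H (w - 2 * size lQ).
have k2 : 2 <= k.
  have H2 : 2 <= H by move: (leq_trans lew Hew); rewrite mulnC leq_pmul2l.
  by rewrite /k leq_min H2 /=; move: lew; clear; lia.
have kH : k <= H by apply: geq_minl.
have lew' : 2 * size lQ <= w - k <= size lQ * H.
  have : 2 * size lQ <= size lQ * H by rewrite mulnC leq_mul2l (leq_trans k2 kH) orbT.
  move: lew Hew; rewrite [(size lQ).+1 * H]mulSn /k; move: (size lQ * H) => sH; clear; lia.
have kw : k <= w by rewrite /k; clear; lia.
have {}uQ : uniq ((v :: q) ++ links lQ) by exact: uQ.
have {}QF : {in (v :: q) ++ links lQ, forall x, x \in F} by exact: QF.
have uQ' : uniq (links lQ) by move: uQ; rewrite cat_uniq => /and3P[].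
have QF' : {in links lQ, forall x, x \in F}.
  by move=> x xQ; apply: QF; rewrite mem_cat xQ orbT.
have uP2' : uniq (flatten [seq [:: P.1; P.2] | P <- map fst lQ]) by case/and3P: uP2.
have [z' [pz' lz' uz' sz' z'P]] := IH _ _ ch QF' uQ' ol uP2' lew'.
have uA : b + #|F| <= #|nbrs u (cl P.2)| by apply: leq_trans leg _; case/setIdP: uP.
have vA : b + #|F| <= #|nbrs v (cl P.1)| by apply: leq_trans leg _; case/setIdP: vP.
have [||||L [pL lL uL sL LP]] := @fill b k.-1 (cl P.1) (cl P.2) u v F _ _ (red_nb rP) uA vA.
- by move=> x /side_cl ->.
- by move=> x /side_cl ->.
- by move: k2; clear; lia.
- by rewrite !card_cl minnn; move: kH k2 lem; card_lia.
have dP x : x \in cl P.1 :|: cl P.2 -> x \notin z' \/ x \in F.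
  move=> xP; case: (boolP (x \in F)) => xF; [by right|left];
    apply/negP => /z'P[/QF'|[_ [c [cl0 xc]]]].
    by rewrite (negbTE xF).
  have clash d : d \in [:: P.1; P.2] -> x \in cl d -> False.
    move=> dP xd; have dc : d != c.
      have : uniq ([:: P.1; P.2] ++ flatten [seq [:: P.1; P.2] | P <- map fst lQ]) := uP2.
      by rewrite cat_uniq => /and3P[_ /hasPn/(_ c cl0) nc _]; apply: contraNneq nc => <-.
    by have := disjointFr (disj_cl dc) xd; rewrite xc.
  by case/setUP: xP => xd; [apply: (clash P.1)|apply: (clash P.2)]; rewrite ?inE ?eqxx ?orbT.
exists (L ++ (v :: q) ++ z'); split.
- by rewrite cat_path pL /= lL /= cat_path pq.
- by rewrite last_cat /= !last_cat lz'.
- have uvq : uniq (v :: q) by move: uQ; rewrite cat_uniq => /andP[].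
  have u2 : uniq ((v :: q) ++ z').
    rewrite cat_uniq uvq uz' andbT; apply/hasPn => x /z'P[xQ|[xF _]].
      by move: uQ; rewrite cat_uniq => /and3P[_ /hasPn/(_ x xQ)].
    by apply: contra xF => xq; apply: QF; rewrite mem_cat xq.
  rewrite cat_uniq uL u2 andbT; apply/hasPn => x; rewrite mem_cat => /orP[xq|xz].
    by apply/negP => /LP /andP[_]; rewrite QF// mem_cat xq.
  by apply/negP => /LP /andP[/dP[|xF]]; rewrite ?xz// xF.
- rewrite !size_cat /= ?size_cat -/(links lQ) sL sz' prednK; last by move: k2; clear; lia.
  by move: kw; clear; lia.
move=> x; rewrite mem_cat => /orP[/LP/andP[xAB xF]|].
  right; split=> //; case/setUP: xAB => xd; [exists P.1|exists P.2]; rewrite !inE eqxx ?orbT //.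
rewrite mem_cat => /orP[xq|/z'P[xQ|[xF [c [cl0 xc]]]]].
- by left; have : x \in (v :: q) ++ links lQ by rewrite mem_cat xq.
- by left; have : x \in (v :: q) ++ links lQ by rewrite mem_cat xQ orbT.
by right; split=> //; exists c; split=> //; rewrite [flatten _]/= !inE cl0 !orbT.
Qed.

(** The chain is started at the last vertex [u0] of its own links, so the assembled path ends where
    it began. The links supply [2 * sg] vertices and [assemble] the remaining [2 * (n - sg)]. *)
Lemma long_cycle H M c0 n : M != [::] -> all oriented M -> {in M, forall P, connect red c0 P.1} ->
  uniq (flatten [seq [:: P.1; P.2] | P <- M]) ->
  2 * b + size M * #|I| <= g -> H + 5 * b + 1 + size M * #|I| <= m ->
  size M * (#|I| + 2) <= n <= size M * H ->
  exists z, [/\ cycle e z, uniq z & size z = 2 * n].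
Proof.
case: M => // P0 M _ oM cM uM leg lem /andP[len Hen].
have oP0 : oriented P0 by case/andP: oM.
have [||lQ [fQ ch uQ _ [sQ eQ]]] := @skeleton c0 P0 (P0 :: M) set0 oP0 (cM _ (mem_head _ _)) oM cM.
- by rewrite cards0 addn0 (leq_trans _ leg)// leq_add2r leq_pmull.
- rewrite cards0 addn0 (leq_trans _ lem)// leq_add2r; clear; lia.
have [u uP] : exists u, u \in rich P0.1 P0.2.
  apply/card_gt0P; apply: leq_trans (red_rich _); last by case/and3P: oP0.
  have : 0 < #|I| by apply/card_gt0P; exists c0.
  by move: leg => /=; rewrite mulSn; card_lia.
have [_ lP0] := ch u uP.
pose u0 := last u (links lQ); have [chu0 _] := ch u0 lP0.
pose F := [set x in links lQ].
have cF : #|F| <= size (P0 :: M) * #|I| by rewrite cardsE (leq_trans (card_size _)).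
pose sg := (size (links lQ))./2.
have esg : size (links lQ) = 2 * sg by rewrite mul2n -[LHS](odd_double_half) (negbTE eQ).
have szQ : size lQ = size (P0 :: M) by rewrite -fQ size_map.
have [||||||z [pz lz uz sz _]] := @assemble H F lQ u0 (n - sg) _ _ chu0 _ uQ.
- by move: leg cF; clear; lia.
- by move: lem cF; clear; lia.
- by move=> x; rewrite inE.
- by rewrite fQ.
- by rewrite fQ.
- rewrite szQ; move: len Hen sQ; rewrite esg; move: (size (P0 :: M)) => S.
  by rewrite mulnDr; move: (S * #|I|) (S * H) => ? ?; clear; lia.
exists z; split=> //; last first.
  rewrite sz esg; move: len sQ; rewrite esg; move: (size (P0 :: M)) => S.
  by rewrite mulnDr; move: (S * #|I|) => ?; clear; lia.
case: z pz lz {uz sz} => // x z pz lz; rewrite -[z]/(behead (x :: z)).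
have lx : last x z = u0.
  rewrite -[LHS]/(last u0 (x :: z)) lz /u0.
  by case: (links lQ) => //.
by rewrite (cycle_path u0) /= lx.
Qed.

End Clusters.
End LongPath.

(** * Partitions without bad pairs *)

Definition cls (U I : finType) (p : U -> I) i := [set u | p u == i].
Definition partial (U I : finType) m (p : U -> I) := [set u | #|cls p (p u)| != m].

Section Chunk.
Variables (U K : finType) (f : U -> K) (m D : nat).

Definition position u := index u (enum (cls f (f u))).
(** Each class of [f] is cut, in the order of [enum], into consecutive runs of [m] elements, the
    last possibly shorter. *)
Definition chunk u : K * 'I_D.+1 := (f u, inord (position u %/ m)).

Hypothesis m_gt0 : 0 < m.
Hypothesis ltU : #|U| < D.+1 * m.

Lemma position_lt u : position u < #|cls f (f u)|.
Proof. by rewrite cardE index_mem mem_enum inE. Qed.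

Lemma position_inj u v : f u = f v -> position u = position v -> u = v.
Proof.
move=> fuv; rewrite /position fuv => e.
have u_in : u \in enum (cls f (f v)) by rewrite mem_enum inE fuv.
have v_in : v \in enum (cls f (f v)) by rewrite mem_enum inE.
by rewrite -(nth_index u u_in) e nth_index.
Qed.

Lemma chunk_eq u v : chunk u = chunk v -> f u = f v /\ position u %/ m = position v %/ m.
Proof.
have lt w : position w %/ m < D.+1.
  rewrite ltn_divLR// (leq_ltn_trans _ ltU)// ltnW// (leq_trans (position_lt w))//.
  exact: max_card.
by case=> fuv /(congr1 val); rewrite /= !inordK.
Qed.

Definition remainder u : 'I_m := Ordinal (ltn_pmod (position u) m_gt0).

Lemma card_chunk i : #|cls chunk i| <= m.
Proof.
rewrite -[leqRHS]card_ord -(card_in_imset (f := remainder)) ?max_card// => u v.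
rewrite !inE => /eqP ui /eqP vi /(congr1 val) /= e.
have [fuv d] := chunk_eq (etrans ui (esym vi)).
by apply: position_inj => //; rewrite (divn_eq (position u) m) d e -divn_eq.
Qed.

Lemma chunk_full u : position u %/ m < #|cls f (f u)| %/ m -> #|cls chunk (chunk u)| = m.
Proof.
move=> lt; apply/eqP; rewrite eqn_leq card_chunk /=.
set s := enum (cls f (f u)); set d := position u %/ m.
have lts (i : 'I_m) : d * m + i < size s.
  rewrite -cardE; have : (d.+1 * m) <= #|cls f (f u)| by rewrite -leq_divRL.
  by rewrite mulSn; move: (ltn_ord i); card_lia.
have fs (i : 'I_m) : f (nth u s (d * m + i)) = f u.
  by have := mem_nth u (lts i); rewrite mem_enum inE => /eqP.
rewrite -[leqLHS]card_ord -(card_imset (f := fun i : 'I_m => nth u s (d * m + i))).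
  apply/subset_leq_card/subsetP => _ /imsetP[i _ ->].
  rewrite inE /chunk /position fs -/s index_uniq ?enum_uniq//.
  by rewrite divnMDl// divn_small// addn0.
move=> i j /eqP; rewrite nth_uniq ?enum_uniq// eqn_add2l => /eqP; exact: val_inj.
Qed.

(** Only the last chunk of a class of [f] can be partial, and its elements differ in their
    remainders. *)
Lemma card_partial_chunk : #|partial m chunk| <= #|K| * m.
Proof.
rewrite -[X in _ * X](card_ord m) -card_prod.
rewrite -(card_in_imset (f := fun u => (f u, remainder u))) ?max_card// => u v.
have last w : w \in partial m chunk -> position w %/ m = #|cls f (f w)| %/ m.
  rewrite inE => ne; apply/eqP; rewrite eqn_leq leq_div2r ?(ltnW (position_lt w))//.
  by rewrite leqNgt; apply: contra ne => /chunk_full ->.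
move=> /last uP /last vP [fuv e]; apply: position_inj => //.
by rewrite (divn_eq (position u) m) uP fuv -vP e -divn_eq.
Qed.

End Chunk.

(** * The linear energy and its decrease under refinement *)

Section Potential.
Variables (U V C : finType) (col : U -> V -> C).

Section Fixed.
Variables (I J : finType) (p : U -> I) (q : V -> J).

Definition colours i j := [set c | [exists u in cls p i, [exists v in cls q j, col u v == c]]].
Definition potential := \sum_(w : U * V) #|colours (p w.1) (q w.2)|.

Lemma coloursP i j c :
  reflect (exists u v, [/\ p u = i, q v = j & col u v = c]) (c \in colours i j).
Proof.
rewrite inE; apply: (iffP exists_inP) => [[u]|[u [v [pu qv e]]]].
  rewrite inE => /eqP pu /exists_inP[v]; rewrite inE => /eqP qv /eqP e.
  by exists u, v.
exists u; first by rewrite inE pu.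
by apply/exists_inP; exists v; rewrite ?inE ?qv ?e.
Qed.

End Fixed.

Section Holes.
Variables (I J : finType) (p : U -> I) (q : V -> J) (E m : nat).
Definition hole i j (w : {set U} * {set V} * C) :=
  [&& w.1.1 \subset cls p i, w.1.2 \subset cls q j, m <= E * #|w.1.1|, m <= E * #|w.1.2|,
    w.2 \in colours p q i j & [forall u in w.1.1, [forall v in w.1.2, col u v != w.2]]].
Definition bad i j := [exists w, hole i j w].
Definition bad_pairs :=
  [set ij : I * J | [&& #|cls p ij.1| == m, #|cls q ij.2| == m & bad ij.1 ij.2]].
Definition holeL i j := if [pick w | hole i j w] is Some w then w.1.1 else set0.
Definition holeR i j := if [pick w | hole i j w] is Some w then w.1.2 else set0.

Lemma bad_hole i j : bad i j -> exists c, hole i j (holeL i j, holeR i j, c).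
Proof.
rewrite /bad /holeL /holeR => /existsP[w0 w0P]; case: pickP => [[[X Y] c] wP|/(_ w0)].
  by exists c.
by rewrite w0P.
Qed.

(** Refinement along a hole removes one colour from the product of its two sets. This product has at
    least [(m / E) ^ 2] elements, whence the factor [E ^ 2]. *)
Lemma potential_drop (I' J' : finType) (p' : U -> I') (q' : V -> J') :
  (forall u u', p' u = p' u' -> p u = p u' /\
    forall j, (u \in holeL (p u) j) = (u' \in holeL (p u) j)) ->
  (forall v v', q' v = q' v' -> q v = q v' /\
    forall i, (v \in holeR i (q v)) = (v' \in holeR i (q v))) ->
  E ^ 2 * potential p' q' + #|bad_pairs| * m ^ 2 <= E ^ 2 * potential p q.
Proof.
move=> refp refq.
pose ind (w : U * V) := [&& (p w.1, q w.2) \in bad_pairs, w.1 \in holeL (p w.1) (q w.2) &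
  w.2 \in holeR (p w.1) (q w.2)].
have le1 : potential p' q' + \sum_(w : U * V) ind w <= potential p q.
  rewrite -big_split /=; apply: leq_sum => -[u v] _ /=.
  have sub : colours p' q' (p' u) (q' v) \subset colours p q (p u) (q v).
    apply/subsetP => c; rewrite inE => /exists_inP[u'].
    rewrite inE => /eqP /refp[pu' _] /exists_inP[v'].
    rewrite inE => /eqP /refq[qv' _] /eqP e; apply/coloursP; exists u', v'; split=> //.
  case: (boolP (ind (u, v))) => [/and3P[]|_]; last by rewrite addn0 subset_leq_card.
  rewrite inE /= => /and3P[_ _ /bad_hole[c /and5P[_ _ _ _ /andP[cP /forall_inP no]]]] uL vR.
  rewrite addn1; apply: proper_card; apply/properP; split=> //; exists c => //.
  apply/negP; rewrite inE => /exists_inP[u']; rewrite inE => /eqP pu' /exists_inP[v'].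
  rewrite inE => /eqP qv' /eqP e.
  have [epu hu] := refp _ _ (esym pu'); have [eqv hv] := refq _ _ (esym qv').
  have := no u'; rewrite -hu uL => /(_ isT) /forall_inP /(_ v').
  by rewrite /= -hv vR e eqxx => /(_ isT).
have le2 : #|bad_pairs| * m ^ 2 <= E ^ 2 * \sum_(w : U * V) ind w.
  rewrite (partition_big (fun w : U * V => (p w.1, q w.2)) xpredT)//= big_distrr /=.
  rewrite -sum_nat_const [leqRHS](bigID (mem bad_pairs)) /=.
  apply: leq_trans (leq_addr _ _); apply: leq_sum => -[i j] ij.
  have /and3P[_ _ /bad_hole[c /and5P[/= /subsetP sL /subsetP sR cL cR _]]] :
    [&& #|cls p i| == m, #|cls q j| == m & bad i j] by have := ij; rewrite inE.
  have : #|setX (holeL i j) (holeR i j)| <= \sum_(w | (p w.1, q w.2) == (i, j)) ind w.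
    rewrite -sum1_card big_mkcond [leqRHS]big_mkcond; apply: leq_sum => -[u v] _.
    rewrite in_setX; case: (boolP (_ \in _)) => //= uL; case: (boolP (_ \in _)) => //= vR.
    have := sL u uL; have := sR v vR; rewrite !inE => /eqP qv /eqP pu.
    by rewrite pu qv eqxx /ind /= pu qv ij uL vR.
  rewrite cardsX => /(leq_mul (leqnn (E ^ 2))); apply: leq_trans.
  have -> : E ^ 2 * (#|holeL i j| * #|holeR i j|) = (E * #|holeL i j|) * (E * #|holeR i j|).
    by rewrite mulnACA.
  by rewrite -mulnn leq_mul.
by rewrite (leq_trans (leq_add (leqnn _) le2))// -mulnDr leq_mul2l le1 orbT.
Qed.

End Holes.
End Potential.

(* After [t] refinements the partition is good or the potential has dropped by  *)
(* [t * N ^ 2 / E ^ 3]; a class is partial if it has fewer than [N %/ D] points. *)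
Definition regular_partition (N k E L t : nat) (col : 'I_N -> 'I_N -> 'I_k) (good : bool) :=
  exists (D : nat) (I J : finType) (p : 'I_N -> I) (q : 'I_N -> J),
    let m := N %/ D in
    [/\ #|I| <= L /\ #|J| <= L, E <= D <= L,
      (forall i, #|cls p i| <= m) /\ (forall j, #|cls q j| <= m),
      E * #|partial m p| <= N /\ E * #|partial m q| <= N &
      if good then E * (#|bad_pairs col p q E m| * m ^ 2) <= N ^ 2
      else E ^ 3 * potential col p q + t * N ^ 2 <= E ^ 3 * k * N ^ 2].

(** Cutting every class along its holes gives at most [L * 2 ^ L] classes, which are then cut into
    chunks. [D'] is [E] times this number, so that partial chunks contain at most [N / E] points. *)
Lemma regular_refine (N k E L L' t D : nat) (col : 'I_N -> 'I_N -> 'I_k)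
    (I J : finType) (p : 'I_N -> I) (q : 'I_N -> J) :
  0 < E -> #|I| <= L -> #|J| <= L -> 0 < L ->
  let m := N %/ D in let D' := E * (L * 2 ^ L) in
  L * 2 ^ L * D'.+1 + D' ^ 2 <= L' -> L' <= N ->
  E ^ 3 * potential col p q + t * N ^ 2 <= E ^ 3 * k * N ^ 2 ->
  N ^ 2 < E * (#|bad_pairs col p q E m| * m ^ 2) ->
  regular_partition E L' t.+1 col false.
Proof.
move=> E0 IL JL L0 m D' hL' NL' pot nbad.
have K0 : 0 < L * 2 ^ L by rewrite muln_gt0 L0 expn_gt0.
have D0 : 0 < D' by rewrite muln_gt0 E0.
have NDD : D' ^ 2 <= N by move: hL' NL'; clear; lia.
have hm : D' <= N %/ D' by rewrite leq_divRL// mulnn.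
have m0 : 0 < N %/ D' := leq_trans D0 hm.
have ltN : #|'I_N| < D'.+1 * (N %/ D').
  by rewrite card_ord mulSn [ltnLHS](divn_eq N D') mulnC addnC ltn_add2r (leq_trans (ltn_pmod N D0)).
pose f u := (p u, [set j | u \in holeL col p q E m (p u) j]).
pose g v := (q v, [set i | v \in holeR col p q E m i (q v)]).
have cK (A B : finType) : #|A| <= L -> #|B| <= L -> #|{: A * {set B}}| <= L * 2 ^ L.
  move=> AL BL; rewrite card_prod -(cardsT {set B}) -powersetT card_powerset cardsT.
  by rewrite leq_mul// leq_exp2l.
have part (A B : finType) (h : 'I_N -> A * {set B}) : #|A| <= L -> #|B| <= L ->
    E * #|partial (N %/ D') (chunk h (N %/ D') D')| <= N.
  move=> AL BL; have := card_partial_chunk h m0 ltN.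
  move/(leq_mul (leqnn E))/leq_trans; apply.
  apply: leq_trans (leq_trunc_div N D'); rewrite mulnA mulnC leq_mul2l; apply/orP; right.
  by rewrite leq_mul2l (cK _ _ AL BL) orbT.
exists D', _, _, (chunk f (N %/ D') D'), (chunk g (N %/ D') D'); split.
- rewrite !card_prod card_ord; split; apply: leq_trans hL'; apply: leq_trans (leq_addr _ _);
    rewrite leq_mul2r; apply/orP; right; rewrite -card_prod; exact: cK.
- apply/andP; split; first by rewrite leq_pmulr.
  apply: leq_trans hL'; apply: leq_trans (leq_addl _ _).
  by rewrite -mulnn leq_pmulr.
- by split=> ij; apply: card_chunk.
- by split; apply: part.
have := @potential_drop _ _ _ col _ _ p q E m _ _ (chunk f (N %/ D') D') (chunk g (N %/ D') D').
have fP u u' : chunk f (N %/ D') D' u = chunk f (N %/ D') D' u' -> p u = p u' /\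
    forall j, (u \in holeL col p q E m (p u) j) = (u' \in holeL col p q E m (p u) j).
  move=> /(chunk_eq m0 ltN)[+ _]; case=> pu /setP h; split=> // j.
  by have := h j; rewrite !inE pu.
have gP v v' : chunk g (N %/ D') D' v = chunk g (N %/ D') D' v' -> q v = q v' /\
    forall i, (v \in holeR col p q E m i (q v)) = (v' \in holeR col p q E m i (q v)).
  move=> /(chunk_eq m0 ltN)[+ _]; case=> qv /setP h; split=> // j.
  by have := h j; rewrite !inE qv.
move=> /(_ fP gP) drop.
move: drop pot nbad; move: (potential _ _ _) (potential _ _ _) (#|bad_pairs _ _ _ _ _| * _) => P P' B.
have e3 x : E ^ 3 * x = E * (E ^ 2 * x) by rewrite mulnA -expnS.
move=> drop; have {drop} : E * (E ^ 2 * P' + B) <= E * (E ^ 2 * P) by rewrite leq_mul2l drop orbT.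
rewrite mulnDr -!e3 mulSn.
move: (E ^ 3 * P') (E ^ 3 * P) (E * B) (N ^ 2) (t * _) (E ^ 3 * k * _); clear; lia.
Qed.

Lemma regular_step (k E t : nat) : 0 < E -> exists L, 0 < L /\
  forall N (col : 'I_N -> 'I_N -> 'I_k), L <= N ->
    regular_partition E L t col false \/ regular_partition E L t col true.
Proof.
move=> E0; elim: t => [|t [L [L0 IH]]].
  exists (E ^ 2 + E + 2); split; first by rewrite addn_gt0 orbT.
  move=> N col NL; left.
  have E2 : E ^ 2 <= N by apply: leq_trans NL; rewrite -addnA leq_addr.
  have hm : E <= N %/ E by rewrite leq_divRL// mulnn.
  have m0 : 0 < N %/ E := leq_trans E0 hm.
  have ltN : #|'I_N| < E.+1 * (N %/ E).
    by rewrite card_ord mulSn [ltnLHS](divn_eq N E) mulnC addnC ltn_add2r (leq_trans (ltn_pmod N E0)).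
  pose f (u : 'I_N) := tt.
  have cI : #|{: unit * 'I_E.+1}| <= E ^ 2 + E + 2.
    by rewrite card_prod card_unit card_ord mul1n; clear; lia.
  exists E, _, _, (chunk f (N %/ E) E), (chunk f (N %/ E) E); split=> //.
  - by rewrite leqnn; clear; lia.
  - by split=> i; apply: card_chunk.
  - have le : E * #|partial (N %/ E) (chunk f (N %/ E) E)| <= N.
      apply: leq_trans (leq_trunc_div N E); rewrite [leqRHS]mulnC leq_mul2l; apply/orP; right.
      by apply: leq_trans (card_partial_chunk f m0 ltN) _; rewrite card_unit mul1n.
    by split.
  rewrite mul0n addn0 -mulnA leq_mul2l; apply/orP; right.
  have -> : k * N ^ 2 = \sum_(w : 'I_N * 'I_N) k.
    by rewrite sum_nat_const card_prod !card_ord mulnC mulnn.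
  by apply: leq_sum => w _; rewrite -[leqRHS]card_ord max_card.
exists (L * 2 ^ L * (E * (L * 2 ^ L)).+1 + (E * (L * 2 ^ L)) ^ 2 + L); split.
  by rewrite addn_gt0 L0 orbT.
set L' := _ + L; move=> N col NL.
have LL' : L <= L' by apply: leq_addl.
have [[D [I [J [p [q [[IL JL] DL cl par pot]]]]]]|[D [I [J [p [q [[IL JL] DL cl par pot]]]]]]] := IH N col (leq_trans LL' NL); last first.
  right; exists D, I, J, p, q; split=> //.
    by split; apply: leq_trans LL'.
  by case/andP: DL => -> /leq_trans -> .
have [nbad|nbad] := leqP (E * (#|bad_pairs col p q E (N %/ D)| * (N %/ D) ^ 2)) (N ^ 2).
  right; exists D, I, J, p, q; split=> //.
    by split; apply: leq_trans LL'.
  by case/andP: DL => -> /leq_trans -> .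
left; apply: (regular_refine E0 IL JL L0 _ NL pot nbad).
exact: leq_addr.
Qed.

(** The potential is at most [k * N ^ 2], so it cannot drop by [N ^ 2 / E ^ 3] more than [E ^ 3 * k]
    times. *)
Lemma regularity (k E : nat) : 0 < E ->
  exists L, forall N (col : 'I_N -> 'I_N -> 'I_k), L <= N -> regular_partition E L 0 col true.
Proof.
move=> E0; have [L [L0 H]] := regular_step k (E ^ 3 * k).+1 E0.
exists L => N col LN; have N0 := leq_trans L0 LN.
case: (H N col LN) => [] [D [I [J [p [q [c1 c2 c3 c4 c5]]]]]]; last first.
  by exists D, I, J, p, q; split.
have N2 : 0 < N ^ 2 by rewrite expn_gt0 N0.
move: c5 N2; rewrite mulSn.
by move: (N ^ 2) (E ^ 3 * potential _ _ _) (E ^ 3 * k) => n P X; move: (X * n); clear; lia.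
Qed.

(** * The reduced graph *)

Lemma cycle_copy (T : finType) (e : rel T) (z : seq T) n : symmetric e ->
  cycle e z -> uniq z -> size z = n -> contains_copy e (cycle_graph n).
Proof.
move=> esym cz uz sz; subst n; case: z cz uz => [|x0 z0] cz uz;
  first by exists (fun i : 'I_0 => match i with Ordinal _ h => match notF h with end end) => -[].
set z := x0 :: z0 in cz uz *.
have step (i : 'I_(size z)) : e (nth x0 z i) (nth x0 z (ordS i)).
  have := cz; rewrite (cycle_path x0) => /(pathP x0) adj /=.
  have [lt|ge] := ltnP i.+1 (size z).
    by rewrite modn_small//; apply: (adj i.+1).
  have ei : i.+1 = size z by apply/eqP; rewrite eqn_leq ge ltn_ord.
  have <- : last x0 z = nth x0 z i by rewrite -nth_last; congr nth; apply: succn_inj;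
    rewrite ei prednK.
  by rewrite ei modnn; apply: (adj 0).
exists (fun i : 'I_(size z) => nth x0 z i).
  by move=> i j /eqP; rewrite nth_uniq// => /eqP; apply: val_inj.
by move=> i j /orP[] /eqP ->; rewrite // esym.
Qed.

Section Reduced.
Variables (N k : nat) (col : 'I_N -> 'I_N -> 'I_k) (I J : finType)
  (p : 'I_N -> I) (q : 'I_N -> J) (E m b g : nat).
Hypothesis m_gt0 : 0 < m.
Hypothesis mE : m <= E * b.
Hypothesis gm : 2 * k * g <= m.

Local Notation T := ('I_N + 'I_N)%type.
Definition left_side (x : T) := if x is inl _ then true else false.

Lemma colour_class_sym c : symmetric (colour_class col c).
Proof. by move=> [u|v] [u'|v']. Qed.

Lemma colour_class_side c x y : colour_class col c x y -> left_side y = ~~ left_side x.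
Proof. by case: x; case: y. Qed.

Definition fullL := {i : I | #|cls p i| == m}.
Definition fullR := {j : J | #|cls q j| == m}.

Definition edges (a : fullL) (b' : fullR) c :=
  [set w in setX (cls p (val a)) (cls q (val b')) | col w.1 w.2 == c].
Definition popular a b' : option 'I_k :=
  if bad col p q E m (val a) (val b') then None
  else [pick c | m ^ 2 <= k * #|edges a b' c|].

(** In a good pair the [m ^ 2] edges use [k] colours, and one colour has at least the average. *)
Lemma popular_None a b' : popular a b' = None -> bad col p q E m (val a) (val b').
Proof.
rewrite /popular; case: ifP => // _; case: pickP => // none _.
have : \sum_c #|edges a b' c| = m ^ 2.
  transitivity #|setX (cls p (val a)) (cls q (val b'))|.
    rewrite -sum1_card (partition_big (fun w => col w.1 w.2) xpredT)//=.
    by apply: eq_bigr => c _; rewrite -sum1_card; apply: eq_bigl => w; rewrite inE.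
  by rewrite cardsX (eqP (valP a)) (eqP (valP b')) mulnn.
have m2 : 0 < m ^ 2 by rewrite expn_gt0 m_gt0.
case: (posnP k) => k0.
  rewrite big1 => [e|c]; first by rewrite -e in m2.
  by exfalso; have := ltn_ord c; rewrite {2}k0.
move=> sum; have : k * (\sum_c #|edges a b' c|) <= \sum_(c : 'I_k) (m ^ 2).-1.
  by rewrite big_distrr /=; apply: leq_sum => c _; rewrite -ltnS prednK// ltnNge none.
by rewrite sum sum_nat_const card_ord leq_pmul2l// -ltnS prednK// ltnn.
Qed.

Lemma popular_Some a b' c : popular a b' = Some c ->
  ~~ bad col p q E m (val a) (val b') /\ m ^ 2 <= k * #|edges a b' c|.
Proof. by rewrite /popular; case: ifP => // _; case: pickP => // c' ? [<-]. Qed.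

Definition cluster (x : fullL + fullR) : {set T} :=
  match x with
  | inl a => [set inl u | u in cls p (val a)]
  | inr b' => [set inr v | v in cls q (val b')]
  end.

Definition reduced c (x y : fullL + fullR) :=
  match x, y with
  | inl a, inr b' | inr b', inl a => popular a b' == Some c
  | _, _ => false
  end.

Lemma reduced_sym c : symmetric (reduced c).
Proof. by move=> [u|v] [u'|v']. Qed.

Lemma card_cluster x : #|cluster x| = m.
Proof.
by case: x => a /=; rewrite card_imset => [|? ? []] //; apply/eqP; exact: (valP a).
Qed.

Lemma cluster_disjoint x y : x != y -> [disjoint cluster x & cluster y].
Proof.
move=> xy; apply/pred0P => z /=; apply/negP => /andP[].
case: x xy => [a|a]; case: y => [a'|a'] xy /imsetP[u + ->] /imsetP[u' + []] //.
  by rewrite !inE => /eqP e /eqP e' eu; case/eqP: xy; congr inl; apply: val_inj; rewrite -e -e' eu.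
by rewrite !inE => /eqP e /eqP e' eu; case/eqP: xy; congr inr; apply: val_inj; rewrite -e -e' eu.
Qed.

Lemma cluster_side c x : x \in cluster c -> left_side x = if c is inl _ then true else false.
Proof. by case: c => a /imsetP[u _ ->]. Qed.

(** A popular colour occurs in the pair, so an empty pair of large subsets would make the pair
    bad. *)
Lemma popular_no_bihole a b' c : popular a b' = Some c ->
  no_bihole (colour_class col c) b (cluster (inl a)) (cluster (inr b')).
Proof.
case/popular_Some=> nb cm S S' SA S'B cS cS'.
case: (boolP [exists x in S, [exists y in S', colour_class col c x y]]) => [/exists_inP[x xS /exists_inP[y yS xy]]|no].
  by exists x, y.
case/negP: nb; apply/existsP.
pose X := [set u | inl u \in S]; pose Y := [set v | inr v \in S'].
have eX : S = [set inl u | u in X].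
  apply/setP => x; apply/idP/imsetP => [xS|[u + ->]]; last by rewrite inE.
  by have /imsetP[u _ e] := subsetP SA x xS; exists u; rewrite // inE -e.
have eY : S' = [set inr u | u in Y].
  apply/setP => x; apply/idP/imsetP => [xS|[u + ->]]; last by rewrite inE.
  by have /imsetP[u _ e] := subsetP S'B x xS; exists u; rewrite // inE -e.
have cX : #|S| = #|X| by rewrite eX card_imset// => ? ? [].
have cY : #|S'| = #|Y| by rewrite eY card_imset// => ? ? [].
exists (X, Y, c); apply/and5P; split=> /=.
- by apply/subsetP => u; rewrite inE => /(subsetP SA)/imsetP[u' ? [->]].
- by apply/subsetP => u; rewrite inE => /(subsetP S'B)/imsetP[u' ? [->]].
- by rewrite -cX (leq_trans mE)// leq_mul2l cS orbT.
- by rewrite -cY (leq_trans mE)// leq_mul2l cS' orbT.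
apply/andP; split.
  apply/coloursP; have : 0 < #|edges a b' c|.
    by move: cm; case: #|_| => //; rewrite muln0 leqn0 expn_eq0 (negbTE (lt0n_neq0 m_gt0)).
  case/card_gt0P=> -[u v]; rewrite !inE /= => /andP[/andP[/eqP pu /eqP qv] /eqP e].
  by exists u, v.
apply/forall_inP => u uX; apply/forall_inP => v vY; apply: contraNneq no => e.
apply/exists_inP; exists (inl u); first by rewrite inE in uX.
by apply/exists_inP; exists (inr v); rewrite ?inE /= ?e//; rewrite inE in vY.
Qed.

Lemma reduced_no_bihole c x y : reduced c x y ->
  no_bihole (colour_class col c) b (cluster x) (cluster y).
Proof.
case: x y => [a|b'] [a'|b''] //= /eqP; first exact: popular_no_bihole.
move/popular_no_bihole; apply: no_bihole_sym; exact: colour_class_sym.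
Qed.

(** Fewer than [g] vertices of degree at least [g] would leave at most [2 * (g - 1) * m] edges,
    which is less than [m ^ 2 / k] by [gm]. *)
Lemma many_rich (e : rel T) (A B : {set T}) : 0 < k -> #|A| = m -> #|B| = m ->
  m ^ 2 <= k * \sum_(u in A) #|nbrs e u B| ->
  g <= #|[set u in A | g <= #|nbrs e u B|]|.
Proof.
move=> k0 cA cB le; case: (posnP g) => [->//|g0]; rewrite leqNgt; apply/negP => lt.
set R := [set u in A | _] in lt.
have : \sum_(u in A) #|nbrs e u B| <= g.-1 * m + m * g.-1.
  apply: (@leq_trans (\sum_(u in A) ((u \in R) * m + g.-1))).
    apply: leq_sum => u uA; case: (boolP (u \in R)) => uR /=.
      rewrite mul1n (leq_trans _ (leq_addr _ _))// -cB subset_leq_card//.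
      by apply/subsetP => v; rewrite inE => /andP[].
    by move: uR; rewrite inE uA /= -ltnNge => uR; rewrite -ltnS prednK.
  rewrite big_split /= sum_nat_const cA leq_add2r -big_distrl /= leq_mul2r; apply/orP; right.
  apply: (@leq_trans #|R|); last by rewrite -ltnS prednK.
  rewrite -sum1_card [leqRHS]big_mkcond [leqLHS]big_mkcond; apply: leq_sum => u _.
  by case: (u \in A); case: (u \in R).
move/(leq_mul (leqnn k))/(leq_trans le); rewrite leqNgt => /negP; apply.
rewrite -mulnn; move: gm k0 g0 m_gt0; clear.
case: g => // g' gm k0 _ m0; rewrite /=.
have -> : k * (g' * m + m * g') = 2 * k * g' * m by lia.
by rewrite ltn_pmul2r// (leq_trans _ gm)// mulnS -[ltnLHS]add0n ltn_add2r muln_gt0.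
Qed.

Lemma popular_degrees a b' c : popular a b' = Some c ->
  #|edges a b' c| = \sum_(u in cluster (inl a)) #|nbrs (colour_class col c) u (cluster (inr b'))| /\
  #|edges a b' c| = \sum_(u in cluster (inr b')) #|nbrs (colour_class col c) u (cluster (inl a))|.
Proof.
move=> _; set X := cls p (val a); set Y := cls q (val b').
have cardL : #|edges a b' c| = \sum_(u in X) \sum_(v in Y | col u v == c) 1.
  by rewrite pair_big_dep /= -sum1_card; apply: eq_bigl => -[u v]; rewrite !inE /= andbA.
split.
  rewrite cardL [RHS]big_imset /=; last by move=> ? ? _ _ [].
  apply: eq_bigr => u _; rewrite sum1dep_card -(card_imset _ (@inr_inj 'I_N 'I_N)).
  congr #|pred_of_set _|; apply/setP => y; apply/imsetP/idP => [[v + ->]|].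
    by rewrite !inE => /andP[vY e]; rewrite /= e andbT; apply/imsetP; exists v; rewrite ?inE.
  by rewrite inE => /andP[/imsetP[v vY ->] /= e]; exists v; rewrite // inE e andbT.
rewrite cardL (exchange_big_dep (mem Y)) /=; last by move=> ? ? _ /andP[].
rewrite [RHS]big_imset /=; last by move=> ? ? _ _ [].
apply: eq_bigr => v vY; have vY' := vY; rewrite inE in vY';
  rewrite sum1dep_card -(card_imset _ (@inl_inj 'I_N 'I_N)).
congr #|pred_of_set _|; apply/setP => y; apply/imsetP/idP => [[u + ->]|].
  by rewrite !inE vY' /= => /andP[uX e]; rewrite e andbT; apply/imsetP; exists u; rewrite ?inE.
by rewrite inE => /andP[/imsetP[u uX ->] /= e]; exists u; rewrite // inE vY e uX.
Qed.

Lemma reduced_rich c x y : reduced c x y ->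
  g <= #|rich (colour_class col c) cluster g x y|.
Proof.
have k0 : 0 < k by apply: leq_ltn_trans (ltn_ord c).
case: x y => [a|b'] [a'|b''] //= /eqP pc; apply: many_rich;
  rewrite ?(card_cluster (inl _)) ?(card_cluster (inr _)) //.
  by have [<- _] := popular_degrees pc; case: (popular_Some pc).
by have [_ <-] := popular_degrees pc; case: (popular_Some pc).
Qed.

Definition component c x := fingraph.root (reduced c) x.

Lemma component_connect c x y : component c x = component c y -> connect (reduced c) x y.
Proof.
by move/eqP; rewrite root_connect//; apply: sym_connect_sym; apply: reduced_sym.
Qed.

Lemma matching_cycle c l M H n : is_matching (fun a b' => (popular a b' == Some c) &&
    (component c (inl a) == l)) M -> M != [::] ->
  2 * b + size M * (#|I| + #|J|) <= g ->
  H + 5 * b + 1 + size M * (#|I| + #|J|) <= m ->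
  size M * (#|I| + #|J| + 2) <= n <= size M * H ->
  exists c, contains_copy (colour_class col c) (cycle_graph (2 * n)).
Proof.
move=> /and3P[uM1 uM2 /allP MP] M0 hg hm hn.
have cI : #|{: fullL + fullR}| <= #|I| + #|J|.
  rewrite card_sum leq_add//; first by rewrite card_sig max_card.
  by rewrite card_sig max_card.
pose M' := [seq (inl x.1, inr x.2) : (fullL + fullR) * (fullL + fullR) | x <- M].
have sM' : size M' = size M by rewrite size_map.
have leI (x : nat) : size M * (#|{: fullL + fullR}| + x) <= size M * (#|I| + #|J| + x).
  by rewrite leq_mul2l leq_add2r cI orbT.
have leI0 : size M * #|{: fullL + fullR}| <= size M * (#|I| + #|J|).
  by rewrite leq_mul2l cI orbT.
have [x0 x0M] : exists x, x \in M by case: (M) M0 => // x M1 _; exists x; rewrite mem_head.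
have /andP[hn1 hn2] := hn.
have [|||||||z [cz uz sz]] := long_cycle (colour_class_sym c) (@colour_class_side c)
   card_cluster cluster_disjoint (@reduced_sym c) (@reduced_no_bihole c) (@reduced_rich c)
   cluster_side (H := H) (M := M') (c0 := inl x0.1) (n := n).
- by rewrite -size_eq0 sM' size_eq0.
- rewrite /M' all_map; apply/allP => x xM; rewrite /oriented /= andbT.
  by case/andP: (MP x xM).
- move=> P; rewrite /M' => /mapP[x xM ->]; apply: component_connect => /=.
  have /andP[_ /eqP ->] := MP x xM.
  by have /andP[_ /eqP ->] := MP x0 x0M.
- rewrite /M'; elim: (M) uM1 uM2 => //= x s IH /andP[x1 u1] /andP[x2 u2].
  rewrite IH// andbT !inE !negb_or /=; apply/andP; split; last first.
    apply: contra x2 => /flattenP[_ /mapP[_ /mapP[y ys ->] ->]].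
    by rewrite !inE /= => /eqP [->]; apply: map_f.
  apply: contra x1 => /flattenP[_ /mapP[_ /mapP[y ys ->] ->]].
  by rewrite !inE /= orbF => /eqP [->]; apply: map_f.
- by rewrite sM' (leq_trans _ hg)// leq_add2l.
- by rewrite sM' (leq_trans _ hm)// leq_add2l.
- by rewrite sM' hn2 andbT (leq_trans (leI 2)).
exists c; exact: (cycle_copy (colour_class_sym c) cz uz sz).
Qed.

Definition lightL h := [set a : fullL | #|[set b' : fullR | popular a b' == None]| <= h].
Definition lightR h := [set b' : fullR | #|[set a : fullL | popular a b' == None]| <= h].

Lemma is_matching_take (A B : eqType) (R : A -> B -> bool) (M : seq (A * B)) s :
  is_matching R M -> is_matching R (take s M).
Proof.
case/and3P=> u1 u2 aM; rewrite /is_matching !map_take !take_uniq//=.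
by apply/allP => x /mem_take; apply: (allP aM).
Qed.

(** Either all components have covers of size at most [s], and a choice of them contradicts
    [cfg_false]; or [koenig] gives a component a matching of more than [s] edges, cut down to [s]
    for [matching_cycle]. *)
Lemma partition_cycle s h d H n : 3 < k -> 100 * h < d -> 0 < s ->
  (2 * k - 3) * s + d <= #|lightL h| -> (2 * k - 3) * s + d <= #|lightR h| ->
  2 * b + s * (#|I| + #|J|) <= g -> H + 5 * b + 1 + s * (#|I| + #|J|) <= m ->
  s * (#|I| + #|J| + 2) <= n <= s * H ->
  exists c, contains_copy (colour_class col c) (cycle_graph (2 * n)).
Proof.
move=> k3 hd s0 hL hR hg hm hn.
pose R c l a b' := (popular a b' == Some c) && (component c (inl a) == l).
pose small c l P := is_cover (R c l) P && (#|P.1| + #|P.2| <= s).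
case: (boolP [forall c, [forall l, [exists P, small c l P]]]) => [/forallP cov|]; last first.
  rewrite negb_forall => /existsP[c]; rewrite negb_forall => /existsP[l].
  rewrite negb_exists => /forallP nP.
  have [M [P [matM covP szM]]] := koenig (R c l).
  have sM : s < size M by rewrite szM ltnNge; have := nP P; rewrite /small covP.
  have szt : size (take s M) = s by rewrite size_takel// ltnW.
  apply: (matching_cycle (c := c) (l := l) (M := take s M) (H := H)); rewrite ?szt//.
    exact: is_matching_take.
  by rewrite -size_eq0 szt -lt0n.
have P_ex c l : exists P, small c l P by apply/existsP/(forallP (cov c)).
pose P c l := xchoose (P_ex c l).
have PP c l : small c l (P c l) := xchooseP (P_ex c l).
pose X c := [set a | a \in (P c (component c (inl a))).1].
pose Y c := [set b' | b' \in (P c (component c (inr b'))).2].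
have lab a b' c : popular a b' = Some c -> component c (inl a) = component c (inr b').
  move=> e; apply/eqP; rewrite root_connect; last exact/sym_connect_sym/reduced_sym.
  by apply: connect1; rewrite /= e.
have K : cfg popular (fun c a => component c (inl a)) (fun c b' => component c (inr b')) X Y s h
    (lightL h) (lightR h) setT.
  split.
  - by move=> a b' c _ _; apply: lab.
  - move=> a b' c _ _ e; have /andP[/forallP/(_ a)/forallP/(_ b')] := PP c (component c (inl a)).
    by rewrite /R e !eqxx /= !inE -(lab _ _ _ e).
  - move=> c l; have /andP[_] := PP c l; apply: leq_trans; apply: leq_add;
      apply/subset_leq_card/subsetP => x.
      by rewrite !inE => /and3P[_ + /eqP <-].
    by rewrite !inE => /and3P[_ + /eqP <-].
  - by [].
  - move=> a; rewrite inE; apply: leq_trans; apply/subset_leq_card/subsetP => b'.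
    by rewrite !inE => /andP[].
  - move=> b'; rewrite inE; apply: leq_trans; apply/subset_leq_card/subsetP => a.
    by rewrite !inE => /andP[].
by exfalso; apply: (cfg_false K _ k3 hd s0 hL hR); rewrite cardsT card_ord.
Qed.

Lemma card_light (A B : finType) (R : A -> B -> bool) h :
  #|{: A}| * h.+1 <= #|[set a | #|[set b' | R a b']| <= h]| * h.+1 + #|[set w : A * B | R w.1 w.2]|.
Proof.
set Z := [set a | _]; have -> : #|{: A}| = #|Z| + #|~: Z| by rewrite cardsC.
rewrite mulnDl leq_add2l.
have -> : #|[set w : A * B | R w.1 w.2]| = \sum_a #|[set b' | R a b']|.
  under [RHS]eq_bigr do rewrite -sum1_card.
  by rewrite pair_big_dep /= -sum1_card; apply: eq_bigl => -[a b']; rewrite !inE.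
rewrite [leqRHS](bigID (mem (~: Z))) /= (leq_trans _ (leq_addr _ _))//.
by rewrite -sum_nat_const; apply: leq_sum => a; rewrite !inE -ltnNge.
Qed.

Lemma card_lightL h : #|{: fullL}| * h.+1 <= #|lightL h| * h.+1 + #|bad_pairs col p q E m|.
Proof.
apply: leq_trans (card_light (fun a b' => popular a b' == None) h) _; rewrite leq_add2l.
rewrite -(card_imset (f := fun w : fullL * fullR => (val w.1, val w.2))).
  apply/subset_leq_card/subsetP => _ /imsetP[[a b'] + ->]; rewrite inE /= => /eqP/popular_None ab.
  by rewrite inE /= ab (valP a) (valP b').
by move=> [a b'] [a1 b1] [/val_inj -> /val_inj ->].
Qed.

Lemma card_lightR h : #|{: fullR}| * h.+1 <= #|lightR h| * h.+1 + #|bad_pairs col p q E m|.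
Proof.
apply: leq_trans (card_light (fun b' a => popular a b' == None) h) _; rewrite leq_add2l.
rewrite -(card_imset (f := fun w : fullR * fullL => (val w.2, val w.1))).
  apply/subset_leq_card/subsetP => _ /imsetP[[b' a] + ->]; rewrite inE /= => /eqP/popular_None ab.
  by rewrite inE /= ab (valP a) (valP b').
by move=> [b' a] [b1 a1] [/val_inj -> /val_inj ->].
Qed.

End Reduced.

Lemma card_full (U K : finType) (f : U -> K) m :
  #|U| <= #|{: {i : K | #|cls f i| == m}}| * m + #|partial m f|.
Proof.
rewrite -(cardsC (partial m f)) addnC leq_add2r -sum1_card.
rewrite (partition_big f (fun i => #|cls f i| == m)) /=; last by move=> u; rewrite !inE negbK.
rewrite card_sig -sum_nat_const; apply: leq_sum => i /eqP e; rewrite -[leqRHS]e.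
rewrite sum1_card subset_leq_card//; apply/subsetP => u.
by rewrite !inE => /andP[].
Qed.

(** * Choice of the parameters *)

(** With [E = 8 * F ^ 2] there are about [D ^ 2 / (2 * F ^ 2)] bad pairs at most, up to a constant
    factor, and a full cluster that is not light lies in more than [h], roughly [D / F], of them. So
    all but a fraction [1 / F] of [D] are light. *)
Lemma num_light (D F full light nbad h m N : nat) : 0 < F -> 0 < m -> 0 < D ->
  D * m <= N -> N <= D.+1 * m -> (8 * F * F) * N <= (8 * F * F) * (full * m) + N ->
  full * h.+1 <= light * h.+1 + nbad -> D <= F * h.+1 ->
  (8 * F * F) * (nbad * m ^ 2) <= N ^ 2 -> F * D <= F * light + D.
Proof.
move=> F0 m0 D0 DN ND hfull hlight hh hbad.
have [E' eE] : exists E', 8 * F * F = E'.+1 by exists (8 * F * F).-1; rewrite prednK// !muln_gt0 F0.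
rewrite eE in hfull hbad.
have a1 : E' * D <= E'.+1 * full.
  rewrite -(leq_pmul2r m0) -!mulnA (@leq_trans (E' * N))//.
    by rewrite leq_mul2l DN orbT.
  by move: hfull; rewrite [E'.+1 * N]mulSn; move: (E' * N) (E'.+1 * _); clear; lia.
have a2 : E'.+1 * nbad <= 4 * D * D.
  rewrite -(leq_pmul2r (m := m ^ 2)) ?expn_gt0 ?m0// -mulnA (leq_trans hbad)//.
  rewrite -!mulnn (leq_trans (leq_mul ND ND))// mulnACA leq_mul2r; apply/orP; right.
  by move: D0; clear; nia.
pose x := full - light.
have a3 : x * h.+1 <= nbad by rewrite mulnBl leq_subLR.
have a4 : x * D <= F * nbad.
  by apply: leq_trans (_ : F * (x * h.+1) <= _);
    rewrite ?leq_mul2l ?a3 ?orbT// mulnCA leq_mul2l hh orbT.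
have a5 : E'.+1 * x <= 4 * F * D.
  rewrite -(leq_pmul2r D0) -mulnA (leq_trans (leq_mul (leqnn _) a4))//.
  rewrite mulnCA (leq_trans (leq_mul (leqnn F) a2))//.
  by clear; nia.
have a6 : E'.+1 * full <= E'.+1 * light + E'.+1 * x.
  by rewrite -mulnDr leq_mul2l /x; clear; lia.
have a7 : E'.+1 * D <= E'.+1 * light + 8 * F * D.
  have : 4 * F * D + D <= 8 * F * D by move: F0; clear; nia.
  rewrite [E'.+1 * D]mulSn; move: a1 a5 a6.
  by move: (E' * D) (E'.+1 * full) (E'.+1 * light) (E'.+1 * x) (4 * F * D) (8 * F * D); clear; lia.
have F8 : 0 < 8 * F by rewrite muln_gt0.
rewrite -(leq_pmul2l F8) mulnDr !mulnA eE; exact: a7.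
Qed.

(** The gain [n / q] in [N] yields [r * s <= (1 - 1 / (2Q)) * (D + 1) + r]. The gap [D / (2Q)]
    equals [202 * D / F], twice what the non-light clusters and [100 * h] may consume; the rest
    absorbs the constants. *)
Lemma num_main (r q D s h light n m N H : nat) :
  let Q := r * q + 1 in let F := 404 * Q in let E := 8 * F * F in
  0 < r -> 0 < q -> 0 < H -> E <= D -> s * H <= n + H -> Q * n <= q * N -> N <= D.+1 * m ->
  E * m <= E * H + 7 * m -> F * h <= D -> F * D <= F * light + D ->
  r * s + (100 * h + 1) <= light.
Proof.
move=> Q F E r0 q0 H0 ED sH Qn ND mH hD lD.
have Q2 : 2 <= Q by rewrite /Q; move: r0 q0; clear; nia.
have EQ : 14 * Q + 8 <= E by rewrite /E /F; move: Q2; clear; nia.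
have [E' eE] : exists E', E = E' + 7 by exists (E - 7); move: EQ; clear; lia.
have mH' : E' * m <= E * H by move: mH; rewrite {1}eE mulnDl leq_add2r.
have b1 : r * s * Q * H <= (Q.-1 * N) + r * Q * H.
  have : r * Q * (s * H) <= r * Q * (n + H) by rewrite leq_mul2l sH orbT.
  have e : r * q = Q.-1 by rewrite /Q addn1.
  have : r * (Q * n) <= r * (q * N) by rewrite leq_mul2l Qn orbT.
  rewrite mulnDr [r * (q * N)]mulnA e !mulnA.
  have -> : r * s * Q * H = r * Q * s * H by rewrite -!mulnA; congr (r * _); rewrite mulnCA.
  by move: (r * Q * s * H) (r * Q * n) (r * Q * H) (Q.-1 * N); clear; lia.
have b2 : r * s * Q * E' <= Q.-1 * D.+1 * E + r * Q * E'.
  rewrite -(leq_pmul2r H0) mulnDl.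
  have : (Q.-1 * N) * E' <= Q.-1 * D.+1 * E * H.
    apply: (@leq_trans (Q.-1 * (D.+1 * m) * E')); first by rewrite leq_mul2r leq_mul2l ND !orbT.
    have -> : Q.-1 * (D.+1 * m) * E' = Q.-1 * D.+1 * (E' * m) by move: (Q.-1) => x; clear; nia.
    by rewrite -[leqRHS]mulnA leq_mul2l mH' orbT.
  have := leq_mul b1 (leqnn E'); rewrite mulnDl.
  have -> : r * s * Q * H * E' = r * s * Q * E' * H by rewrite mulnAC.
  have -> : r * Q * H * E' = r * Q * E' * H by rewrite mulnAC.
  move: (r * s * Q * E' * H) (Q.-1 * N * E') (r * Q * E' * H) (Q.-1 * D.+1 * E * H); clear; lia.
have E'0 : 0 < E' by move: eE EQ; clear; lia.
have b3 : 2 * (r * s * Q) <= (2 * Q).-1 * D.+1 + 2 * (r * Q).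
  rewrite -(leq_pmul2r E'0) mulnDl.
  have : 2 * (Q.-1 * D.+1 * E) <= (2 * Q).-1 * D.+1 * E'.
    have : 2 * (Q.-1 * E) <= (2 * Q).-1 * E'.
      have [P eP] : exists P, Q = P.+1 by exists Q.-1; rewrite prednK// (leq_trans _ Q2).
      by move: EQ; rewrite eE eP /=; clear; nia.
    move=> /(leq_mul (leqnn D.+1)).
    have -> : D.+1 * (2 * (Q.-1 * E)) = 2 * (Q.-1 * D.+1 * E) by move: (D.+1) (Q.-1) => x y;
      clear; nia.
    by have -> : D.+1 * ((2 * Q).-1 * E') = (2 * Q).-1 * D.+1 * E' by rewrite mulnCA mulnA.
  move: b2; rewrite -[2 * _ * E']mulnA -[2 * (r * Q) * E']mulnA.
  by move: (r * s * Q * E') (Q.-1 * D.+1 * E) (r * Q * E') (_ * D.+1 * E') => *; lia.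
have DQ : 8 * Q + 4 * (r * Q) <= D.
  apply: leq_trans ED; have : r <= Q by rewrite /Q; move: q0; clear; nia.
  by rewrite /E /F; move: Q2; clear; nia.
have F0 : 0 < F by rewrite /F muln_gt0 (leq_trans _ Q2).
have P0 : (2 * Q).-1 * D.+1 + D + 1 = 2 * (Q * D) + 2 * Q.
  have [P eP] : exists P, Q = P.+1 by exists Q.-1; rewrite prednK// (leq_trans _ Q2).
  by rewrite eP; clear; nia.
rewrite -(leq_pmul2l F0).
have : F * (r * s) = 202 * (2 * (r * s * Q)) by rewrite /F; clear; nia.
have : F * (100 * h + 1) = 100 * (F * h) + F by rewrite mulnDr mulnCA muln1.
have : F * D = 404 * (Q * D) by rewrite /F mulnA.
move=> e3 e2 e1; rewrite mulnDr e1 e2; rewrite e3 in lD.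
have eF : F = 404 * Q by [].
by move: b3 DQ P0 hD lD Q2; rewrite eF;
  move: (r * s * Q) (_ * D.+1) (r * Q) (_ * h) (_ * light) (Q * D); clear; lia.
Qed.

(** [b] is the hole size, [g] the degree of rich vertices, [H] half the order available in a matched
    pair; [2 * L ^ 2] allows for the vertices of the links. *)
Lemma num_sizes (k E L m : nat) : 16 * k + 7 <= E -> 0 < k -> E * (3 + L ^ 2) + L <= m ->
  let b := m %/ E + 1 in let g := m %/ (2 * k) in let H := m - (5 * b + 1 + 2 * L ^ 2) in
  [/\ m <= E * b, 2 * k * g <= m, 2 * b + 2 * L ^ 2 <= g,
      H + 5 * b + 1 + 2 * L ^ 2 = m & E * m <= E * H + 7 * m].
Proof.
move=> hE k0 hm b g H.
have E0 : 0 < E by move: hE; clear; lia.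
have mb : m <= E * b by rewrite /b addn1 mulnC ltnW// ltn_ceil.
have bm : E * b <= m + E by rewrite /b mulnDr muln1 leq_add2r mulnC leq_trunc_div.
have hs : E * (5 * b + 1 + 2 * L ^ 2) <= 7 * m.
  have -> : E * (5 * b + 1 + 2 * L ^ 2) = 5 * (E * b) + E + 2 * (E * L ^ 2).
    by rewrite 2!mulnDr muln1 (mulnCA E 5) (mulnCA E 2).
  by move: bm hm; rewrite !mulnDr; move: (E * L ^ 2) (E * b) => x y; clear; lia.
have leH : 5 * b + 1 + 2 * L ^ 2 <= m.
  rewrite -(leq_pmul2l E0) (leq_trans hs)// leq_mul2r; apply/orP; right; move: hE; clear; lia.
split=> //.
- by rewrite mulnC leq_trunc_div.
- rewrite leq_divRL ?muln_gt0// mulnC -(leq_pmul2l E0).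
  have : 2 * k * (E * (2 * b + 2 * L ^ 2)) <= E * m.
    have h1 : E * (2 * b + 2 * L ^ 2) <= 4 * m.
      rewrite mulnDr !(mulnCA E 2); move: bm hm; rewrite !mulnDr.
      by move: (E * L ^ 2) (E * b) => x y; clear; lia.
    apply: leq_trans (leq_mul (leqnn (2 * k)) h1) _.
    by rewrite mulnA leq_mul2r; apply/orP; right; move: hE; clear; lia.
  by rewrite mulnCA.
- by move: leH; rewrite /H; move: (5 * b) (2 * L ^ 2) => x y; clear; lia.
by move: hs; rewrite /H mulnBr; move: (E * _) (E * m) => x y; clear; lia.
Qed.

Lemma card_sig_le (I : finType) (P : pred I) : #|{: {i : I | P i}}| <= #|I|.
Proof. by rewrite card_sig max_card. Qed.

Lemma cycle_arrows k q : 3 < k -> 0 < q -> exists n0, forall n, n0 <= n ->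
  bipartite_arrows k (cycle_graph (2 * n)) ((2 * k - 3) * n + n %/ q + 1).
Proof.
move=> k3 q0; pose r := 2 * k - 3; pose Q := r * q + 1; pose F := 404 * Q; pose E := 8 * F * F.
have r5 : 5 <= r by rewrite /r; move: k3; clear; lia.
have rk : k <= r by rewrite /r; move: k3; clear; lia.
have F0 : 0 < F by rewrite /F /Q addn1.
have E0 : 0 < E by rewrite /E; move: (F) F0 => x x0; rewrite !muln_gt0 x0.
have rQ : r <= Q by rewrite /Q; move: q0; clear; nia.
have Ek : 16 * k + 7 <= E by rewrite /E /F; move: rk rQ r5; clear; nia.
have k0 : 0 < k by move: k3; clear; lia.
have [L reg] := regularity k E0.
pose M0 := E * (3 + L ^ 2) + L.
exists (L * M0 + L * (2 * L + 2) + L + 1) => n hn col.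
set N := (2 * k - 3) * n + n %/ q + 1 in col *.
have nN : n <= N.
  rewrite /N -/r; have : n <= r * n by rewrite leq_pmull// (leq_trans _ r5).
  by move: (r * n) (n %/ q) => x y; clear; lia.
have LN : L <= N by apply: leq_trans nN; move: hn; clear; lia.
have [D [I [J [p [p' [[cI cJ] /andP[ED DL] [clI clJ] [parI parJ] hbad]]]]]] := reg N col LN.
set m := N %/ D in clI clJ parI parJ hbad.
have D0 : 0 < D := leq_trans E0 ED.
have hm : M0 <= m.
  rewrite leq_divRL//; apply: leq_trans nN; apply: leq_trans hn.
  by rewrite -!addnA (leq_trans _ (leq_addr _ _))// mulnC leq_mul2r DL orbT.
have Dm : D <= m by apply: leq_trans hm; rewrite /M0; move: DL; clear; lia.
have m0 : 0 < m := leq_trans D0 Dm.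
have DN : D * m <= N by rewrite mulnC leq_trunc_div.
have ND : N <= D.+1 * m.
  by rewrite mulSn [leqLHS](divn_eq N D) mulnC addnC leq_add2r (leq_trans (ltnW (ltn_pmod N D0))).
have [mE gm hg hH EH] := num_sizes Ek k0 hm.
set b := m %/ E + 1 in mE hg hH EH; set g := m %/ (2 * k) in gm hg.
set H := m - _ in hH EH.
have H0 : 0 < H.
  move: EH Ek m0; clear; case: H => //; rewrite muln0 add0n => h Ek m0.
  by move: h; rewrite leq_pmul2r//; move: Ek; clear; lia.
(* [s] matched pairs suffice for [2 * n] vertices, and a light cluster may lie in up to [h] missing
   pairs. *)
pose s := n %/ H + 1; pose h := D %/ F.
have sH : s * H <= n + H by rewrite /s mulnDl mul1n leq_add2r leq_trunc_div.
have nsH : n <= s * H by rewrite /s addn1 ltnW// ltn_ceil.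
have Qn : Q * n <= q * N.
  rewrite /Q /N -/r !mulnDr mulnDl mul1n muln1 mulnA [q * r]mulnC -addnA leq_add2l.
  by rewrite [leqLHS](divn_eq n q) mulnC leq_add2l ltnW// ltn_pmod.
have hD : F * h <= D by rewrite mulnC leq_trunc_div.
have hh : D <= F * h.+1 by rewrite mulnC ltnW// ltn_ceil.
have full (K : finType) (f : 'I_N -> K) : E * #|partial m f| <= N ->
    E * N <= E * (#|{: {i : K | #|cls f i| == m}}| * m) + N.
  move=> par; have := leq_mul (leqnn E) (card_full f m); rewrite card_ord mulnDr => /leq_trans;
    apply.
  by rewrite leq_add2l.
have lightL_ge : r * s + (100 * h + 1) <= #|lightL col p p' E m h|.
  apply: (num_main (q := q) (D := D) (n := n) (m := m) (N := N) (H := H)) => //.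
    by rewrite (leq_trans _ r5).
  apply: (num_light F0 m0 D0 DN ND (full _ _ parI) _ hh hbad).
  exact: card_lightL.
have lightR_ge : r * s + (100 * h + 1) <= #|lightR col p p' E m h|.
  apply: (num_main (q := q) (D := D) (n := n) (m := m) (N := N) (H := H)) => //.
    by rewrite (leq_trans _ r5).
  apply: (num_light F0 m0 D0 DN ND (full _ _ parJ) _ hh hbad).
  exact: card_lightR.
have sL : s <= L.
  have : r * s <= L.
    apply: leq_trans cI; apply: leq_trans (card_sig_le (fun i => #|cls p i| == m)).
    by apply: leq_trans (leq_trans (leq_addr _ _) lightL_ge) (max_card _).
  by apply: leq_trans; rewrite leq_pmull// (leq_trans _ r5).
have IJ : #|I| + #|J| <= 2 * L by rewrite mul2n -addnn leq_add.
have sIJ : s * (#|I| + #|J|) <= 2 * L ^ 2.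
  by apply: leq_trans (leq_mul sL IJ) _; rewrite mulnCA mulnn.
apply: (@partition_cycle N k col I J p p' E m b g m0 mE gm s h (100 * h + 1) H n) => //.
- by rewrite addn1.
- by rewrite /s addn1.
- by rewrite (leq_trans _ hg)// leq_add2l.
- by rewrite -hH leq_add2l.
rewrite nsH andbT; apply: leq_trans hn.
have : s * (#|I| + #|J| + 2) <= L * (2 * L + 2) by rewrite leq_mul// leq_add2r.
move/leq_trans; apply; apply: leq_trans (leq_addl (L * M0) _) _.
by rewrite -[leqRHS]addnA leq_addr.
Qed.

(** * Ramsey numbers *)

Lemma pigeonhole (S T : finType) (f : T -> S) n : 0 < #|T| -> #|S| * n <= #|T| ->
  exists s, n <= #|[set t | f t == s]|.
Proof.
move=> T0 le; case: (pickP (fun s => n <= #|[set t | f t == s]|)) => [s|none]; first by exists s.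
case: n => [|n] in le none *; first by have /card_gt0P[t _] := T0; have := none (f t).
have S0 : 0 < #|S| by have /card_gt0P[t _] := T0; apply/card_gt0P; exists (f t).
have : #|T| <= #|S| * n.
  rewrite -sum1_card (partition_big f xpredT)//= -sum_nat_const; apply: leq_sum => s _.
  rewrite sum1_card -ltnS ltnNge; apply/negP => lt; have /negP := none s; case.
  by rewrite (leq_trans lt)// subset_leq_card//; apply/subsetP => t; rewrite inE.
by move/(leq_trans le); rewrite leq_pmul2l// ltnn.
Qed.

Lemma biclique_cycle (N k : nat) (col : 'I_N -> 'I_N -> 'I_k) c n (A B : {set 'I_N}) :
  0 < n -> n <= #|A| -> n <= #|B| -> (forall u v, u \in A -> v \in B -> col u v = c) ->
  contains_copy (colour_class col c) (cycle_graph (2 * n)).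
Proof.
move=> n0 cA cB colAB; have [a0 _] : exists a, a \in A by apply/card_gt0P/(leq_trans n0).
pose x i := nth a0 (enum A) i; pose y i := nth a0 (enum B) i.
have lt (i : 'I_(2 * n)) : i./2 < n by rewrite ltn_half_double -mul2n.
have xA (i : 'I_(2 * n)) : x i./2 \in A by rewrite -mem_enum mem_nth// -cardE (leq_trans (lt i)).
have yB (i : 'I_(2 * n)) : y i./2 \in B by rewrite -mem_enum mem_nth// -cardE (leq_trans (lt i)).
pose f (i : 'I_(2 * n)) : 'I_N + 'I_N := if odd i then inr (y i./2) else inl (x i./2).
have step i : colour_class col c (f i) (f (ordS i)).
  have od : odd (2 * n) = false by rewrite mul2n odd_double.
  have : odd (ordS i) = ~~ odd i by rewrite [LHS]odd_mod.
  by rewrite /f => ->; case: (odd i); apply/eqP; apply: (colAB _ _ (xA _) (yB _)).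
exists f.
  move=> i j; have half_inj : odd i = odd j -> i./2 = j./2 -> i = j.
    by move=> o h; apply: val_inj; rewrite /= -[LHS]odd_double_half o h odd_double_half.
  rewrite /f; case oi : (odd i); case oj : (odd j) => // -[/eqP];
    rewrite nth_uniq ?enum_uniq// -?cardE ?(leq_trans (lt _))// => /eqP;
    by apply: half_inj; rewrite oi oj.
move=> i j /orP[] /eqP ->; first exact: step.
by have := step j; case: (f j) => ?; case: (f _).
Qed.

(** Some [n] right vertices see [k * n] fixed left vertices in the same colour pattern, which has
    one colour on [n] of them: a monochromatic [K_{n,n}]. This makes the Ramsey number exist for
    small [n] too. *)
Lemma cycle_arrows_exists k n : 0 < k -> 0 < n ->
  exists N, bipartite_arrows k (cycle_graph (2 * n)) N.
Proof.
move=> k0 n0; pose a := k * n; pose M := #|{ffun 'I_a -> 'I_k}|.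
have a0 : 0 < a by rewrite muln_gt0 k0.
have aN : a <= M * n + a by apply: leq_addl.
exists (M * n + a) => col.
have [||phi cB] := @pigeonhole {ffun 'I_a ->
  'I_k} 'I_(M * n + a) (fun v => [ffun u => col (widen_ord aN u) v]) n.
- by rewrite card_ord (leq_trans a0).
- by rewrite card_ord leq_addr.
have [||c cA] := @pigeonhole 'I_k 'I_a phi n; rewrite ?card_ord//.
exists c; apply: (biclique_cycle (A := widen_ord aN @: [set u | phi u == c])) cB _ => //.
  by rewrite card_imset// => u v /(congr1 val) /= /val_inj.
move=> _ v /imsetP[u + ->]; rewrite !inE => /eqP <- /eqP <-.
by rewrite ffunE.
Qed.

Lemma path_sub_cycle m (x y : 'I_m) : path_graph m x y -> cycle_graph m x y.
Proof.
suff step (i j : 'I_m) : j == i.+1 :> nat -> j == ordS i.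
  by rewrite /path_graph /cycle_graph => /orP[/step ->|/step ->]; rewrite ?orbT.
by move=> /eqP e; apply/eqP/val_inj; rewrite /= -e modn_small.
Qed.

Lemma bipartite_arrows_sub k (V : finType) (H H' : rel V) N : (forall x y, H x y -> H' x y) ->
  bipartite_arrows k H' N -> bipartite_arrows k H N.
Proof.
by move=> HH' arr col; have [c [f finj fH]] := arr col; exists c; exists f => // x y /HH'/fH.
Qed.

(* Passage to the asymptotic bound *)
From mathcomp Require Import all_boot all_order all_algebra.
From mathcomp Require Import all_classical all_reals all_analysis.
Import Order.TTheory GRing.Theory Num.Theory numFieldNormedType.Exports.
Local Open Scope classical_set_scope.
Local Open Scope ring_scope.
Unset Implicit Arguments.

(** [o n] is the excess of the Ramsey number divided by [n] over [2k - 3], cut off at 0. For fixed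
    [q] and large [n >= q] it is at most [1 / q + 1 / n <= 2 / q]. *)
Lemma ramsey_asymptotics (R : realType) (k n1 : nat) (H : forall n, rel 'I_(2 * n)) :
  (3 < k)%N -> (0 < n1)%N ->
  (forall n, (n1 <= n)%N -> exists N, bipartite_arrows k (H n) N) ->
  (forall q, (0 < q)%N -> exists n0, forall n, (n0 <= n)%N ->
     bipartite_arrows k (H n) ((2 * k - 3) * n + n %/ q + 1)) ->
  exists2 o : nat -> R, o @ \oo --> (0 : R) &
    forall n : nat, (n1 <= n)%N -> exists2 N : nat, is_bipartite_ramsey_number k (H n) N &
      N%:R <= (2 * k%:R - 3 + o n) * n%:R.
Proof.
move=> k3 n10 ex upper.
have [r rP] : exists r : nat -> nat, forall n, (n1 <= n)%N ->
  is_bipartite_ramsey_number k (H n) (r n).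
  have /choice[r rP] : forall n, exists N, (n1 <= n)%N -> is_bipartite_ramsey_number k (H n) N.
    move=> n; case: (boolP (n1 <= n)%N) => [le|_]; last by exists 0%N.
    have exN : exists N, `[< bipartite_arrows k (H n) N >].
      by have [N arr] := ex n le; exists N; apply/asboolP.
    case: (ex_minnP exN) => N /asboolP arr minN; exists N => _; split=> // M arrM.
    by apply: minN; apply/asboolP.
  by exists r.
pose o n : R := Num.max 0 ((r n)%:R / n%:R - (2 * k%:R - 3)).
exists o; last first.
  move=> n le; exists (r n); first exact: rP.
  have n0 : (0 : R) < n%:R by rewrite ltr0n (leq_trans n10).
  rewrite -ler_pdivrMr// -lerBlDl /o le_max; apply/orP; right.
  exact: lexx.
apply/cvgrPdist_le => e e0.
pose q := (Num.truncn (2 / e)).+1.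
have qe : 2 / q%:R <= e :> R.
  rewrite ler_pdivrMr ?ltr0n// mulrC -ler_pdivrMr// ltW//.
  exact: truncnS_gt.
have [n0 arr] := upper q isT.
near=> n.
have nn0 : (n0 <= n)%N by near: n; exact: nbhs_infty_ge.
have nn1 : (n1 <= n)%N by near: n; exact: nbhs_infty_ge.
have nq : (q <= n)%N by near: n; exact: nbhs_infty_ge.
have np : (0 : R) < n%:R by rewrite ltr0n (leq_trans n10).
have q0 : (0 : R) < q%:R by rewrite ltr0n.
rewrite sub0r normrN ger0_norm; last by rewrite /o le_max lexx.
rewrite /o ge_max ltW//= lerBlDl ler_pdivrMr//.
have [_ /(_ _ (arr n nn0))] := rP n nn1; rewrite -(ler_nat R) => /le_trans; apply.
rewrite !natrD natrM natrB ?natrM; last by rewrite (leq_trans _ (leq_mul (leqnn 2) k3)).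
rewrite -addrA [leRHS]mulrDl lerD2l.
apply: le_trans (_ : 2 / q%:R * n%:R <= _); last by rewrite ler_wpM2r// ltW.
have h1 : (n %/ q)%:R <= n%:R / q%:R :> R.
  by rewrite ler_pdivlMr// -natrM ler_nat leq_trunc_div.
have h2 : 1 <= n%:R / q%:R :> R by rewrite ler_pdivlMr// mul1r ler_nat.
by apply: le_trans (lerD h1 h2) _; rewrite mulrAC -mulrDl -mulr2n mulr_natl.
Unshelve. all: by end_near.
Qed.

Theorem theorem1 (R : realType) (k : nat) (hk : (4 <= k)%N) :
  (exists2 o : nat -> R, o @ \oo --> (0 : R) &
     forall n : nat, (2 <= n)%N ->
       exists2 N : nat, is_bipartite_ramsey_number k (cycle_graph (2 * n)%N) N &
         N%:R <= (2 * k%:R - 3 + o n) * n%:R)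
  /\
  (exists2 o : nat -> R, o @ \oo --> (0 : R) &
     forall n : nat, (1 <= n)%N ->
       exists2 N : nat, is_bipartite_ramsey_number k (path_graph (2 * n)%N) N &
         N%:R <= (2 * k%:R - 3 + o n) * n%:R).
Proof.
have k0 : (0 < k)%N by apply: leq_trans hk.
have sub n N : bipartite_arrows k (cycle_graph (2 * n)) N ->
  bipartite_arrows k (path_graph (2 * n)) N.
  by apply: bipartite_arrows_sub => x y; apply: path_sub_cycle.
split.
  apply: (@ramsey_asymptotics R k 2 (fun n => cycle_graph (2 * n)) hk) => // [n n2|q q0].
    by apply: cycle_arrows_exists => //; apply: ltnW.
  exact: cycle_arrows.
apply: (@ramsey_asymptotics R k 1 (fun n => path_graph (2 * n)) hk) => // [n n1|q q0].
  by have [N arr] := cycle_arrows_exists k0 n1; exists N; apply: sub.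
by have [n0 arr] := cycle_arrows hk q0; exists n0 => n /arr/sub.
Qed.
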